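(* Let $H=\left(\bigcup_{i\in I_1}P_{2\ell_i}\right)\cup\left(\bigcup_{j\in I_2}P_{2\ell_j+1}\right)$ be a linear forest with $|I_1\cup I_2|=k\geq 2$ components, where $\ell_i\geq 2$ for $i\in I_1$ and $\ell_j\geq 1$ for $j\in I_2$, let $\ell=\sum_{i=1}^k\ell_i$ and assume $H\neq kP_3$. Let $F$ be a graph without isolated vertices with $\chi(F)\geq 3$ and $\beta_1(F)=1$. Then there is $N=N(H,F)$ such that for all $n\geq N$, $$ex(n,\{H,F\})=(\ell-1)(n-\ell+1)+D_{F,H},$$ where $D_{F,H}=0$ if the pair $(F,H)$ has property $\mathscr{R}$ and $D_{F,H}=1$ otherwise.
   Context: All graphs are finite and simple. $ex(n,\mathscr{F})$ is the maximum number of edges of an $n$-vertex graph containing no member of $\mathscr{F}$ as a subgraph. $P_m$ is the path on $m$ vertices; the components of $H$ are vertex-disjoint paths, $I_1$ indexing even paths and $I_2$ odd paths. $\chi$ is the chromatic number. An edge control set of $F$ is a set $E'\subseteq E(F)$ such that every edge not in $E'$ shares an endpoint with some edge of $E'$; $\beta_1(F)$ is its minimum size. When $\beta_1(F)=1$ with edge control set $\{u_1u_2\}$, $f(F)=\min\{d_F(u_1),d_F(u_2)\}$. $N(F,K_3)$ is the number of triangles in $F$. The pair $(F,H)$ has property $\mathscr{R}$ if at least one of: (1) $I_1\neq\emptyset$; (2) $v(F)\leq \ell+1$; (3) $N(F,K_3)=1$ and $f(F)\leq \ell$. *)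

(* Defs.v *)
From mathcomp Require Import all_boot.
Set Implicit Arguments. Unset Strict Implicit. Unset Printing Implicit Defensive.


Record sgraph (T : finType) := SGraph {
  adj : rel T;
  adj_sym : symmetric adj;
  adj_irr : irreflexive adj }.

Definition edges (T : finType) (g : rel T) : {set {set T}} :=
  [set e | [exists x, exists y, g x y && (e == [set x; y])]].

Definition nedges (T : finType) (g : rel T) : nat := #|edges g|.

Definition contains (A B : finType) (gA : rel A) (gB : rel B) : bool :=
  [exists phi : {ffun B -> A},
     injectiveb phi && [forall x, forall y, gB x y ==> gA (phi x) (phi y)]].

Definition ffrel n (g : {ffun 'I_n * 'I_n -> bool}) : rel 'I_n :=
  fun x y => g (x, y).

Definition simpleb n (g : {ffun 'I_n * 'I_n -> bool}) : bool :=
  [forall x, ~~ g (x, x)] && [forall x, forall y, g (x, y) == g (y, x)].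

Definition ex2 (n : nat) (A B : finType) (H : rel A) (F : rel B) : nat :=
  \max_(g : {ffun 'I_n * 'I_n -> bool} |
        [&& simpleb g, ~~ contains (ffrel g) H & ~~ contains (ffrel g) F])
     nedges (ffrel g).

(* Linear forests: a component (b, l) is the path P_{2l} if b = true
   (even path, index set I_1) and P_{2l+1} if b = false (odd path, I_2). *)
Definition lf_sizes (s : seq (bool * nat)) : seq nat :=
  [seq (if c.1 then 2 * c.2 else (2 * c.2).+1) | c <- s].

Definition LFV (s : seq (bool * nat)) : finType :=
  {i : 'I_(size (lf_sizes s)) & 'I_(nth 0 (lf_sizes s) i)}.

Definition lf_adj (s : seq (bool * nat)) : rel (LFV s) :=
  fun x y => (tag x == tag y) &&
    (((tagged x : nat).+1 == (tagged y : nat)) ||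
     ((tagged y : nat).+1 == (tagged x : nat))).

Arguments lf_adj s : clear implicits.

Definition ell (s : seq (bool * nat)) : nat := sumn [seq c.2 | c <- s].

Section GraphParams.
Variables (T : finType) (F : sgraph T).

Definition deg (x : T) : nat := #|[set y | adj F x y]|.

Definition no_isolated : Prop := forall x, exists y, adj F x y.

Definition colorable (k : nat) : bool :=
  [exists c : {ffun T -> 'I_k}, [forall x, forall y, adj F x y ==> (c x != c y)]].

Lemma colorable_exists : exists k, colorable k.
Proof.
exists #|T|; apply/existsP; exists [ffun x => enum_rank x].
apply/forallP => x; apply/forallP => y; apply/implyP => hxy.
rewrite !ffunE; apply/negP => /eqP /enum_rank_inj exy.
by move: hxy; rewrite exy (adj_irr F).
Qed.

Definition chi : nat := ex_minn colorable_exists.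

Definition edge_control (E : {set {set T}}) : bool :=
  (E \subset edges (adj F)) &&
  [forall e in edges (adj F) :\: E, exists e' in E, e :&: e' != set0].

Lemma edge_control_exists :
  exists k, [exists E : {set {set T}}, edge_control E && (#|E| == k)].
Proof.
exists #|edges (adj F)|; apply/existsP; exists (edges (adj F)).
rewrite eqxx andbT /edge_control subxx /=.
by apply/forall_inP => e; rewrite setDv inE.
Qed.

Definition beta1 : nat := ex_minn edge_control_exists.

Definition fF : nat :=
  \big[minn/#|T|]_(p : T * T | adj F p.1 p.2 && edge_control [set [set p.1; p.2]])
     minn (deg p.1) (deg p.2).

Definition ntri : nat :=
  #|[set S : {set T} | (#|S| == 3) &&
      [forall x in S, forall y in S, (x != y) ==> adj F x y]]|.

End GraphParams.

Definition propR (T : finType) (F : sgraph T) (s : seq (bool * nat)) : bool :=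
  [|| has (fun c => c.1) s,
      #|T| <= (ell s).+1
    | (ntri F == 1) && (fF F <= ell s)].

Definition D_FH (T : finType) (F : sgraph T) (s : seq (bool * nat)) : nat :=
  if propR F s then 0 else 1.

(* Main.v *)
Require Import Defs.
From mathcomp Require Import all_boot.
From mathcomp Require Import zify.
Set Implicit Arguments. Unset Strict Implicit. Unset Printing Implicit Defensive.

(** Write [m = ell - 1].  The lower bound is the complete bipartite graph
    [K_{m,n-m}], plus one edge inside the large side when [D = 1].

    For the upper bound, delete vertices from an [H]-free graph with at least
    [m(n-m)] edges so as to maximise [e(W) - (m - 1/4)|W|].  The remaining set
    [W] is still large, and every [X] inside it meets at least [(m - 1/4)|X|]
    edges.  As [W] has no long path, a depth-first search yields many disjoint
    connected sets with one and the same neighbourhood [B].  Every case other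
    than [|B| = m] with many of the sets being singletons produces a copy of
    [H]: zigzag between [B] and the sets, and apply the Erdos-Gallai theorem
    inside the sets when [|B| < m].  So there are [m] vertices [S] with many
    common neighbours.  As [F] has an edge meeting all its edges, [S] is
    independent.  An edge outside [S] lengthens zigzags through [S]; hence each
    such edge can be charged to a non-adjacent pair between [S] and the rest,
    except for at most one edge, both ends of which are joined to all of [S].
    Such an edge is impossible when [I_1] is nonempty, and it completes a copy
    of [F] in the two other cases of property R. *)

(** * Edge counts and the Erdos-Gallai theorem *)

(** Pigeonhole over the [size p] consecutive pairs of [x :: p]: [belast x p] lists their first
    members and [p] their second ones, so two counts that together exceed the number of pairs meet
    in some pair. *)
Lemma crossing (V : Type) (P Q : pred V) x (p : seq V) :
  size p < count P p + count Q (belast x p) ->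
  exists c1 y y' c2, [/\ x :: p = c1 ++ [:: y, y' & c2], Q y & P y'].
Proof.
elim: p x => [|a p IH] x //=.
case Px: (P a); case Qx: (Q x) => /= h.
- by exists [::], x, a, p.
- case: (IH a); first by lia.
  by move=> c1 [y [y' [c2 [-> ? ?]]]]; exists (x :: c1), y, y', c2.
- case: (IH a); first by lia.
  by move=> c1 [y [y' [c2 [-> ? ?]]]]; exists (x :: c1), y, y', c2.
- case: (IH a); first by lia.
  by move=> c1 [y [y' [c2 [-> ? ?]]]]; exists (x :: c1), y, y', c2.
Qed.

Section EdgeCounts.
Variables (V : finType) (g : rel V).
Hypotheses (gs : symmetric g) (gi : irreflexive g).
Implicit Types (X Y A B U : {set V}) (q : seq V).

(** Ordered pairs are counted, so [e2 X X] is twice the number of edges inside [X]; the density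
    conditions below carry this factor. *)
Definition e2 X Y := \sum_(x in X) \sum_(y in Y) (g x y : nat).

Definition gpath_in U q := [&& sorted g q, uniq q & all (mem U) q].

Lemma e2_sym X Y : e2 X Y = e2 Y X.
Proof.
rewrite /e2 exchange_big /=; apply: eq_bigr => y _.
by apply: eq_bigr => x _; rewrite gs.
Qed.

Lemma e2_splitl A B Y : B \subset A -> e2 A Y = e2 B Y + e2 (A :\: B) Y.
Proof. by move=> h; rewrite /e2 (big_setID B) (setIidPr h). Qed.

Lemma e2_splitr A B X : B \subset A -> e2 X A = e2 X B + e2 X (A :\: B).
Proof. by move=> h; rewrite e2_sym (e2_splitl _ h) !(e2_sym X). Qed.

Lemma e2_split A B : B \subset A ->
  e2 A A = e2 B B + 2 * e2 B (A :\: B) + e2 (A :\: B) (A :\: B).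
Proof.
move=> h; rewrite (e2_splitl _ h) !(e2_splitr _ h) (e2_sym (A :\: B) B); lia.
Qed.

Lemma e2_leP X Y k : (forall x, x \in X -> e2 [set x] Y <= k) -> e2 X Y <= k * #|X|.
Proof.
move=> h; rewrite mulnC -sum_nat_const; apply: leq_sum => x xX.
by have := h x xX; rewrite /e2 big_set1.
Qed.

Lemma e2_le X Y : e2 X Y <= #|X| * #|Y|.
Proof.
rewrite mulnC; apply: e2_leP => x _; rewrite /e2 big_set1 -sum1_card.
by apply: leq_sum => y _; case: (g x y).
Qed.

Lemma e21 x Y : e2 [set x] Y = #|[set y in Y | g x y]|.
Proof.
rewrite /e2 big_set1 -sum1_card big_mkcond [RHS]big_mkcond /=.
by apply: eq_bigr => y _; rewrite inE; case: (y \in Y); case: (g x y).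
Qed.

Lemma e211 x : e2 [set x] [set x] = 0.
Proof. by rewrite /e2 !big_set1 gi. Qed.

Lemma e2_sum X Y : e2 X Y = \sum_(x in X) e2 [set x] Y.
Proof. by apply: eq_bigr => x _; rewrite /e2 big_set1. Qed.

(* A connected set is one that has no nonempty proper subset without outgoing edges. *)
Definition gsep U X :=
  [&& X != set0, X \proper U & [forall x in X, forall y in U :\: X, ~~ g x y]].

Lemma gsep_e2 U X : gsep U X -> e2 X (U :\: X) = 0.
Proof.
case/and3P=> _ _ /forall_inP h; apply: big1 => x xX; apply: big1 => y yU.
by have /forall_inP/(_ y yU)/negbTE-> := h x xX.
Qed.

Lemma deg_on_path U x q : (forall y, y \in U -> g x y -> y \in q) -> uniq q ->
  e2 [set x] U <= count (g x) q.
Proof.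
move=> h uq; rewrite e21 -size_filter cardE; apply: uniq_leq_size; first exact: enum_uniq.
by move=> y; rewrite mem_enum inE mem_filter => /andP[yU gxy]; rewrite gxy h.
Qed.

Lemma sorted_rev q : sorted g (rev q) = sorted g q.
Proof. by rewrite rev_sorted; case: q => //= x p; apply: eq_path => a b; rewrite gs. Qed.

Lemma gpath_rev U q : gpath_in U (rev q) = gpath_in U q.
Proof. by rewrite /gpath_in rev_uniq all_rev sorted_rev. Qed.

Lemma path_rev_cons a y s : path g a (rev (y :: s)) = g a (last y s) && path g y s.
Proof.
rewrite -[path g y s]/(sorted g (y :: s)) -[sorted g (y :: s)]sorted_rev.
by rewrite lastI rev_rcons.
Qed.

(** A crossing reroutes the path: follow it from [x] to [y], jump to its last vertex, walk back to
    [y'], and close up at [x]. *)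
Lemma crossing_cycle x p c1 y y' c2 : path g x p -> x :: p = c1 ++ [:: y, y' & c2] ->
  g (last x p) y -> g x y' -> cycle g (c1 ++ y :: rev (y' :: c2)).
Proof.
move=> sp E gy gy'.
have lastE : last y' c2 = last x p by rewrite -(last_cons x x p) E last_cat.
case: c1 E => [|x1 c1] [E1 E2].
  rewrite /= rcons_path path_rev_cons lastE -E1 rev_cons last_rcons.
  rewrite gs E1 in gy; rewrite E1 gy -E1 gs gy' andbT /=.
  by move: sp; rewrite E2 /= => /andP[].
move: sp; rewrite E2 cat_path /= => /and4P[p1 g1 g2 p2].
rewrite rcons_cat cat_path -E1 p1 /= g1 rcons_path path_rev_cons p2 lastE gs gy /=.
by rewrite rev_cons last_rcons gs gy'.
Qed.

(** If an end of the path has a neighbour in [U] off the path, prolong it there. Otherwise both ends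
    have all their neighbours on the path, a crossing turns it into a cycle on the same vertices,
    and connectedness gives an edge leaving the cycle, which is then cut open at that edge. *)
Lemma dense_path_step U d q :
  (forall x, x \in U -> d <= e2 [set x] U) -> (forall X, ~~ gsep U X) ->
  0 < size q <= 2 * d -> size q < #|U| -> gpath_in U q ->
  exists q', gpath_in U q' /\ size q' = (size q).+1.
Proof.
move=> hd hc sq sU.
have ext x p : gpath_in U (x :: p) -> (exists2 y, y \in U & g x y && (y \notin x :: p)) ->
    exists q', gpath_in U q' /\ size q' = (size (x :: p)).+1.
  move=> /and3P[s1 s2 s3] [y yU /andP[gxy yp]]; exists [:: y, x & p]; split => //.
  by rewrite /gpath_in /= gs gxy; rewrite /= in yp s1 s2 s3; rewrite s1 yp s2 yU s3.
case: q sq sU => [//|x p] sq sU gq.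
have [/existsP[y /andP[yU h]]|/existsPn nx] :=
  boolP [exists y, (y \in U) && (g x y && (y \notin x :: p))]; first by apply: ext => //; exists y.
set b := last x p.
have [/existsP[y /andP[yU h]]|/existsPn nb] :=
  boolP [exists y, (y \in U) && (g b y && (y \notin x :: p))].
  have gq' : gpath_in U (last x p :: rev (belast x p)) by rewrite -rev_rcons -lastI gpath_rev.
  case: (ext _ _ gq').
    by exists y => //; rewrite -rev_rcons -lastI mem_rev.
  by move=> q' [ga sz]; exists q'; split; rewrite // sz /= size_rev size_belast.
have /and3P[sp up ap] := gq.
have xU : x \in U by move: ap => /= /andP[].
have bU : b \in U by move/allP: ap; apply; exact: mem_last.
have dx : e2 [set x] U <= count (g x) p.
  apply: (leq_trans (deg_on_path (q := x :: p) _ up)); last by rewrite /= gi.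
  by move=> y yU gxy; have := nx y; rewrite yU gxy /= negbK.
have db : e2 [set b] U <= count (g b) (belast x p).
  apply: (leq_trans (deg_on_path (q := x :: p) _ up)).
    by move=> y yU gxy; have := nb y; rewrite yU gxy /= negbK.
  by rewrite lastI -cats1 count_cat /= -/b gi !addn0.
(* The two end degrees add up to at least [2 * d], which exceeds [size p] because
   [size (x :: p) <= 2 * d]. *)
have [|c1 [y [y' [c2 [E gy gy']]]]] := @crossing _ (g x) (g b) x p.
  have := hd _ xU; have := hd _ bU; move: sq; rewrite /=; lia.
pose c := rcons c1 y ++ rev (y' :: c2).
have cyc : cycle g c.
  by rewrite /c cat_rcons; apply: (crossing_cycle sp E).
have permc : perm_eq c (x :: p).
  by rewrite E /c cat_rcons perm_cat2l perm_cons perm_rev.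
have sc : size c = size (x :: p) := perm_size permc.
have uc : uniq c by rewrite (perm_uniq permc).
have cU : {subset c <= U} by move=> z; rewrite (perm_mem permc) => /(allP ap).
pose X := [set z in c].
have cX : #|X| = size c by rewrite cardsE; apply/card_uniqP.
have := hc X; rewrite /gsep negb_and => /orP[|].
  rewrite negbK -cards_eq0 cX sc //.
rewrite negb_and => /orP[|].
  rewrite properEcard cX sc sU andbT => /negP[]; apply/subsetP=> z.
  by rewrite inE => /cU.
case/forall_inPn => w; rewrite inE => wc /forall_inPn[u].
rewrite 2!inE => /andP[uc' uU]; rewrite negbK => gwu.
have [i s' Es] := rot_to wc.
exists (u :: w :: s'); split; last by rewrite -sc -(size_rot i c) Es.
have ur : uniq (w :: s') by rewrite -Es rot_uniq.
have mr z : (z \in w :: s') = (z \in c) by rewrite -Es mem_rot.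
apply/and3P; split.
- rewrite /= gs gwu /=; have := cyc; rewrite -(rot_cycle i) Es /=.
  by rewrite rcons_path => /andP[].
- by rewrite cons_uniq ur mr uc'.
- by apply/allP => z; rewrite in_cons (mr z) => /predU1P[->|/cU].
Qed.

(** Erdos-Gallai for paths with [2 * d] edges, by induction on [#|U|]. Deleting a vertex of degree
    below [d] preserves the density, and one side of a disconnected [U] inherits it. In the
    remaining case a path grows one vertex at a time. *)
Lemma dense_path U d : (2 * d - 1) * #|U| < e2 U U ->
  exists q, gpath_in U q /\ size q = (2 * d).+1.
Proof.
have [k] := ubnP #|U|; elim: k U => // k IH U /ltnSE Uk dU.
have [x xU] : exists x, x \in U.
  by apply/set0Pn/eqP => U0; move: dU; rewrite U0 /e2 big_set0.
case: (posnP d) => [->|d0].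
  by exists [:: x]; rewrite /gpath_in /= xU.
have subP X q : X \subset U -> gpath_in X q -> gpath_in U q.
  move=> /subsetP XU /and3P[h1 h2 h3]; apply/and3P; split=> //.
  by apply/allP => z /(allP h3) /XU.
have [/forall_inP hd|/forall_inPn[v vU hv]] := boolP [forall x in U, d <= e2 [set x] U]; last first.
  have vs : [set v] \subset U by rewrite sub1set.
  case: (IH (U :\ v)).
  - by move: Uk; rewrite (cardsD1 v) vU.
  - move: dU; rewrite (e2_split vs) e211.
    rewrite (e2_splitr _ vs) e211 in hv.
    rewrite (cardsD1 v) vU; nia.
  by move=> q [gq sq]; exists q; split=> //; apply: (subP (U :\ v)); rewrite ?subsetDl.
have [/existsP[X sX]|/existsPn hc] := boolP [exists X, gsep U X].
  have /and3P[X0 pX _] := sX; have XU := proper_sub pX.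
  have E := e2_split XU; rewrite gsep_e2 // in E.
  have cX := cardsID X U; rewrite (setIidPr XU) in cX.
  have cp := proper_card pX; have cp0 : 0 < #|X| by rewrite card_gt0.
  have [h|h] := ltnP ((2 * d - 1) * #|X|) (e2 X X).
    case: (IH X) => //; first by lia.
    by move=> q [gq sq]; exists q; split=> //; apply: (subP X).
  case: (IH (U :\: X)); first by lia.
    nia.
  by move=> q [gq sq]; exists q; split=> //; apply: (subP _ _ _ gq); rewrite subsetDl.
(* [e2 U U] is at most [#|U| * (#|U| - 1)], so the density alone forces this many vertices. *)
have bU : 2 * d < #|U|.
  have h : e2 U U <= (#|U| - 1) * #|U|.
    apply: e2_leP => z zU; have zs : [set z] \subset U by rewrite sub1set.
    rewrite (e2_splitr _ zs) e211; apply: leq_trans (e2_le _ _) _.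
    by rewrite cards1 mul1n [in X in _ <= X](cardsD1 z) zU; lia.
  have : 0 < #|U| by apply/card_gt0P; exists x.
  nia.
have : forall t, 0 < t <= (2 * d).+1 -> exists q, gpath_in U q /\ size q = t.
  elim=> [//|[|t] IHt] ht; first by exists [:: x]; rewrite /gpath_in /= xU.
  case: IHt => [|q [gq sq]]; first by lia.
  case: (dense_path_step hd hc _ _ gq) => [||q' [gq' sq']]; try by rewrite sq; lia.
  by exists q'; split=> //; rewrite sq' sq.
by apply; lia.
Qed.

End EdgeCounts.

(** * Connected sets with a common neighbourhood *)

(** A set of [(K * 2 ^ h).+1 * N.+1] vertices with fewer than [K * 2 ^ h] components has a component
    with more than [N] vertices. The iteration provides for [t] descents into such components. *)
Definition comb_bound h K t := iter t (fun N => (K * 2 ^ h).+1 * N.+1) 1.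

Section CommonNeighbourhood.
Variables (V : finType) (g : rel V).
Hypotheses (gs : symmetric g) (gi : irreflexive g).
Implicit Types (X Y A B C U T W : {set V}) (q : seq V).

Definition gr U : rel V := fun x y => [&& x \in U, y \in U & g x y].

Definition conn U := forall X, ~~ gsep g U X.

Definition nb W T := [set y in W :\: T | [exists x in T, g x y]].

Lemma gr_sym U : connect_sym (gr U).
Proof. by apply: sym_connect_sym => x y; rewrite /gr gs andbCA. Qed.

Lemma conn_connect U x y : conn U -> x \in U -> y \in U -> connect (gr U) x y.
Proof.
move=> cU xU yU; pose X := [set z in U | connect (gr U) x z].
have := cU X; rewrite /gsep negb_and => /orP[|].
  rewrite negbK => /eqP X0; have : x \in X by rewrite inE xU connect0.
  by rewrite X0 inE.
rewrite negb_and => /orP[|].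
  rewrite /proper; have -> /= : X \subset U by apply/subsetP => z; rewrite inE => /andP[].
  by rewrite negbK => /subsetP/(_ y yU); rewrite inE => /andP[].
case/forall_inPn => a; rewrite inE => /andP[aU xa] /forall_inPn[b].
rewrite !inE negbK => /andP[nb bU] gab; case/negP: nb; rewrite bU.
by apply: connect_trans xa _; apply: connect1; rewrite /gr aU bU.
Qed.

Lemma comp_partition U : exists P : {set {set V}},
  partition P U /\ forall C, C \in P ->
    conn C /\ forall x y, x \in C -> y \in U -> g x y -> y \in C.
Proof.
exists (equivalence_partition (connect (gr U)) U); split.
  apply: equivalence_partitionP => x y z _ _ _; split; first exact: connect0.
  by move=> xy; rewrite (same_connect (@gr_sym U) xy).
move=> _ /imsetP[x xU ->].
have cl a b : a \in [set y in U | connect (gr U) x y] -> b \in U -> g a b ->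
    b \in [set y in U | connect (gr U) x y].
  rewrite !inE => /andP[aU xa] bU gab; rewrite bU; apply: connect_trans xa _.
  by apply: connect1; rewrite /gr aU bU.
split=> // X; set C := [set y in U | connect (gr U) x y] in cl *.
apply/negP=> /and3P[/set0Pn[z zX] /properP[XC [y yC yX]] /forall_inP h].
case/negP: yX.
have cX : closed (gr U) (mem X).
  apply: intro_closed; first exact: gr_sym.
  move=> a b /and3P[aU bU gab] aX; apply/negPn/negP=> bX.
  have bC : b \in C := cl a b (subsetP XC _ aX) bU gab.
  have /forall_inP/(_ b) := h a aX.
  by rewrite inE bX bC gab => /(_ isT).
have zC := subsetP XC _ zX; move: zC yC; rewrite !inE => /andP[_ xz] /andP[_ xy].
rewrite -[y \in X](closed_connect cX (x := z)) //.
by apply: connect_trans xy; rewrite gr_sym.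
Qed.

(** Depth-first search: [a] is the stack, a path with its newest vertex first, and [U] is an
    unexplored part whose neighbours in [W] lie in [U] or on the stack. The hypothesis on [X] says
    that each union of components of [U] is adjacent to the top of the stack. As no path has [h]
    vertices, the descent must end at a set with many components. *)
Lemma comb W h K t a U : 0 < K ->
  sorted g a -> uniq a -> (forall x, x \in U -> x \notin a) -> U \subset W ->
  (forall x y, x \in U -> y \in W -> g x y -> (y \in U) || (y \in a)) ->
  (forall X, X != set0 -> X \subset U -> (forall x y, x \in X -> y \in U -> g x y -> y \in X) ->
     if a is a0 :: _ then exists2 x, x \in X & g x a0 else True) ->
  size a + t = h -> comb_bound h K t <= #|U| ->
  (forall q, sorted g q -> uniq q -> size q < h) ->
  exists B (Ts : {set {set V}}), [/\ K <= #|Ts|, trivIset Ts &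
    forall T, T \in Ts -> [/\ T \subset W, T != set0, conn T & nb W T = B]].
Proof.
move=> K0 + + + + + + + + noP; elim: t a U => [|t IH] a U sa ua Ua UW cl att st cU.
  by have := noP a sa ua; rewrite -st addn0 ltnn.
have [P [pP hP]] := comp_partition U.
have PU C : C \in P -> C \subset U.
  by move=> CP; rewrite -(cover_partition pP); apply: bigcup_sup.
have P0 C : C \in P -> C != set0.
  by move=> CP; apply: contraTneq CP => ->; have /and3P[] := pP.
have [large|small] := leqP (K * 2 ^ h) #|P|.
  (* Distinct components of [U] are not adjacent, so a component has neighbours only on the
     stack. *)
  have nbA C : C \in P -> nb W C \in powerset [set x in a].
    move=> CP; rewrite inE; apply/subsetP=> y; rewrite !inE.
    case/andP=> /andP[yC yW] /exists_inP[x xC gxy].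
    have xU := subsetP (PU _ CP) _ xC.
    case/orP: (cl x y xU yW gxy) => // yU.
    by case/negP: yC; have [_ clC] := hP _ CP; apply: clC xC yU gxy.
  have [/exists_inP[B BA hB]|/exists_inPn nB] :=
    boolP [exists B in powerset [set x in a], K <= #|[set C in P | nb W C == B]|].
    exists B, [set C in P | nb W C == B]; split=> //.
      apply: (trivIsetS (Q := P)); last by have /and3P[] := pP.
      by apply/subsetP=> C; rewrite inE => /andP[].
    move=> C; rewrite inE => /andP[CP /eqP <-]; split=> //.
    + exact: subset_trans (PU _ CP) UW.
    + exact: P0.
    + by have [] := hP _ CP.
  (* The stack has at most [2 ^ h] subsets; fewer than [K] components for each of them would
     contradict [large]. *)
  have : #|P| <= \sum_(B in powerset [set x in a]) (K - 1).
    rewrite -sum1_card (partition_big (nb W) (mem (powerset [set x in a]))) //=.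
    apply: leq_sum => B BA; have := nB B BA; rewrite -ltnNge.
    suff -> : \sum_(C in P | nb W C == B) 1 = #|[set C in P | nb W C == B]| by lia.
    by rewrite -sum1_card; apply: eq_bigl => C; rewrite inE.
  rewrite sum_nat_const card_powerset => hle.
  have ca : #|[set x in a]| <= h by rewrite cardsE (card_uniqP ua) -st leq_addr.
  have := leq_pexp2l (isT : 0 < 2) ca; have := expn_gt0 2 #|[set x in a]|.
  rewrite /= => e0 e1; move: (leq_trans large hle).
  move: (2 ^ h) (2 ^ _) e0 e1 => u v e0 e1; nia.
have [C CP bC] : exists2 C, C \in P & comb_bound h K t < #|C|.
  have [/exists_inP//|/exists_inPn hC] := boolP [exists C in P, comb_bound h K t < #|C|].
  have : #|U| <= \sum_(C in P) comb_bound h K t.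
    rewrite (card_partition pP); apply: leq_sum => C CP.
    by have := hC C CP; rewrite -leqNgt.
  rewrite sum_nat_const => hU; exfalso.
  have {cU} : (K * 2 ^ h).+1 * (comb_bound h K t).+1 <= #|U| := cU.
  move: (K * 2 ^ h) (comb_bound h K t) small hU => u v small hU; nia.
have [cC clC] := hP C CP; have CU := PU C CP.
have [x xC hx] : exists2 x, x \in C & path g x a.
  case: a {IH} sa ua Ua cl att st => [|a0 a] sa ua Ua cl att st.
    by have /set0Pn[x xC] := P0 C CP; exists x.
  by have [x xC gx] := att C (P0 C CP) CU clC; exists x => //; rewrite /= gx.
apply: (IH (x :: a) (C :\ x)) => //.
- by rewrite /= ua Ua // (subsetP CU).
- move=> y; rewrite !inE => /andP[/negbTE-> yC]; exact: Ua (subsetP CU _ yC).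
- by apply: subset_trans UW; apply: subset_trans CU; exact: subsetDl.
- move=> u y; rewrite !inE => /andP[_ uC] yW guy.
  case/orP: (cl u y (subsetP CU _ uC) yW guy) => [yU|->]; last by rewrite !orbT.
  by rewrite (clC _ _ uC yU guy) andbT orbA orNb.
(* A union of components not adjacent to the new top [x] would be separated from the rest of the
   connected set [C]. *)
- move=> X X0 XC clX.
  have [/exists_inP[y yX gy]|/exists_inPn hX] := boolP [exists y in X, g y x]; first by exists y.
  case/negP: (cC X); apply/and3P; split=> //.
    apply/properP; split; first exact: subset_trans XC (subsetDl _ _).
    by exists x => //; apply/negP=> /(subsetP XC); rewrite !inE eqxx.
  apply/forall_inP=> u uX; apply/forall_inP=> y; rewrite inE => /andP[yX yC].
  apply/negP=> guy; case/negP: yX; apply: (clX u y) => //.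
  by rewrite !inE yC andbT; apply: contraNneq (hX u uX) => <-.
- by rewrite -st /= addSnnS.
- by move: bC; rewrite (cardsD1 x C) xC.
Qed.

(** Up to an additive constant, [f (~: W)] for the kept set [W], and hence the quantity maximised
    here, is four times the number of edges inside minus [m - 1/4] per vertex. The whole vertex set
    scores at least [4 * m * (#|V| - m)], whereas fewer than [N] vertices score at most
    [2 * N ^ 2 + (4 * m - 1) * #|V|]; hence the lower bound on [#|V|]. *)
Lemma dense_core m N : 0 < m -> 2 * m * (#|V| - m) <= e2 g setT setT ->
  2 * N ^ 2 + 4 * m ^ 2 < #|V| ->
  exists W, N <= #|W| /\ forall X, X \subset W ->
    (4 * m - 1) * #|X| + 2 * e2 g (W :\: X) (W :\: X) <= 2 * e2 g W W.
Proof.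
move=> m0 hm hN.
pose f (X : {set V}) := 2 * e2 g X X + (4 * m - 1) * #|~: X|.
have [//|W _ maxW] := @arg_maxnP _ setT predT f.
exists W; split.
  rewrite leqNgt; apply/negP => ltN.
  have := maxW setT isT; rewrite /f setCT cards0 => h.
  have h2 := e2_le g W W; have h3 := cardsC W; nia.
move=> X XW; have := maxW (W :\: X) isT; rewrite /f => h.
have E : #|~: (W :\: X)| = #|~: W| + #|X|.
  have := cardsC W; have := cardsC (W :\: X); have := cardsID X W.
  by rewrite (setIidPr XW); lia.
move: h; rewrite E; nia.
Qed.

(** At most [#|nb W T|] edges leave [T] at each of its vertices, so the rest of the edges that must
    meet [T] lie inside. The loss of [1/4] per vertex doubles to [1/2] in [e2], still less than the
    [1] that [dense_path] tolerates. *)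
Lemma core_density m W T : (forall X, X \subset W ->
    (4 * m - 1) * #|X| + 2 * e2 g (W :\: X) (W :\: X) <= 2 * e2 g W W) ->
  T \subset W -> T != set0 -> #|nb W T| < m ->
  (2 * (m - #|nb W T|) - 1) * #|T| < e2 g T T.
Proof.
move=> hW TW T0 pm; have := hW T TW; rewrite (e2_split gs TW).
have T0' : 0 < #|T| by rewrite card_gt0.
have : e2 g T (W :\: T) <= #|nb W T| * #|T|.
  apply: e2_leP => x xT; rewrite e21; apply: subset_leq_card.
  apply/subsetP=> y; rewrite !inE => /andP[-> gxy] /=.
  by apply/exists_inP; exists x.
nia.
Qed.

(** Removing the single vertex [x] shows that its degree in [W] is at least [m - 1/4], hence at
    least [m] by integrality. *)
Lemma core_mindeg m W T x : (forall X, X \subset W ->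
    (4 * m - 1) * #|X| + 2 * e2 g (W :\: X) (W :\: X) <= 2 * e2 g W W) ->
  T \subset W -> x \in T -> m <= e2 g [set x] T + #|nb W T|.
Proof.
move=> hW TW xT; have xs : [set x] \subset W by rewrite sub1set (subsetP TW).
have := hW _ xs; rewrite (e2_split gs xs) e211 // cards1 => h.
have : e2 g [set x] (W :\ x) <= e2 g [set x] W by rewrite (e2_splitr gs _ xs) leq_addl.
rewrite (e2_splitr gs _ TW).
have : e2 g [set x] (W :\: T) <= #|nb W T|.
  rewrite e21; apply: subset_leq_card.
  apply/subsetP=> y; rewrite !inE => /andP[-> gxy] /=.
  by apply/exists_inP; exists x.
lia.
Qed.

End CommonNeighbourhood.

(** * Embedding linear forests *)

Lemma flatten_nth_inj (V : eqType) (x0 : V) (qs : seq (seq V)) i j a b :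
  uniq (flatten qs) -> i < size qs -> j < size qs ->
  a < size (nth [::] qs i) -> b < size (nth [::] qs j) ->
  nth x0 (nth [::] qs i) a = nth x0 (nth [::] qs j) b -> i = j /\ a = b.
Proof.
elim: qs i j => // q qs IH i j /=; rewrite cat_uniq => /and3P[uq /hasPn dj uf].
have out k c p : p < size q -> k < size qs -> c < size (nth [::] qs k) ->
    nth x0 q p = nth x0 (nth [::] qs k) c -> False.
  move=> pq kq ck E; suff /dj/negP[] : nth x0 q p \in flatten qs by exact: mem_nth.
  by rewrite E; apply/flattenP; exists (nth [::] qs k); exact: mem_nth.
case: i j => [|i] [|j] //=; rewrite ?ltnS.
- by move=> _ _ aq bq /eqP; rewrite nth_uniq // => /eqP.
- by move=> _ jq aq bq /out-/(_ aq jq bq).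
- by move=> iq _ aq bq /esym/out-/(_ bq iq aq).
- by move=> iq jq aq bq E; have [-> ->] := IH i j uf iq jq aq bq E.
Qed.

Section Embedding.
Variables (V : finType) (g : rel V).
Hypotheses (gs : symmetric g) (gi : irreflexive g).
Implicit Types (X Y A B C U T W : {set V}) (q p Z zs : seq V) (Ts : seq {set V}) (x y z a b : V).

Definition linear_in (ns : seq nat) :=
  exists qs : seq (seq V), [/\ map size qs = ns, all (sorted g) qs & uniq (flatten qs)].

Lemma linear_contains (x0 : V) s : linear_in (lf_sizes s) -> contains g (lf_adj s).
Proof.
case=> qs [sz so uq].
have sq : size qs = size (lf_sizes s) by rewrite -sz size_map.
have sqi i : i < size qs -> size (nth [::] qs i) = nth 0 (lf_sizes s) i.
  by move=> iq; rewrite -sz (nth_map [::]).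
apply/existsP.
exists [ffun x : LFV s => nth x0 (nth [::] qs (tag x)) (tagged x)]; apply/andP; split.
  apply/injectiveP=> -[i a] [j b]; rewrite !ffunE /= => E.
  have iq : i < size qs by rewrite sq.
  have jq : j < size qs by rewrite sq.
  case: (flatten_nth_inj uq iq jq _ _ E); rewrite ?sqi //.
  move=> /val_inj ij; move: b jq E; rewrite -ij => b _ _ /val_inj ->//.
apply/forallP=> -[i a]; apply/forallP=> -[j b]; apply/implyP; rewrite /lf_adj !ffunE /=.
case/andP=> /eqP ij; move: b; rewrite -ij => b.
have iq : i < size qs by rewrite sq.
have si : sorted g (nth [::] qs i) by apply: (allP so); apply: mem_nth.
have := @sortedP _ g _ x0; move=> sp; have {}sp := elimT (sp _) si.
by case/orP=> /eqP ab; [|rewrite gs]; rewrite -ab; apply: sp; rewrite sqi // ab.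
Qed.

(** A long path is cut into consecutive segments of the prescribed sizes. *)
Lemma path_linear ns q : sorted g q -> uniq q -> size q = sumn ns -> linear_in ns.
Proof.
move=> so uq sq; suff [qs [h1 h2 h3]] :
  exists qs : seq (seq V), [/\ map size qs = ns, all (sorted g) qs & flatten qs = q].
  by exists qs; rewrite h3.
elim: ns q so {uq} sq => [|n ns IH] q so /= sq.
  by exists [::]; split=> //=; case: q sq {so}.
have [|qs [h1 h2 h3]] := IH _ (drop_sorted n so); first by rewrite size_drop sq addKn.
exists (take n q :: qs); split=> /=.
- by rewrite h1 size_takel // sq leq_addr.
- by rewrite h2 take_sorted.
- by rewrite h3 cat_take_drop.
Qed.

Lemma sorted_catrev x p q : path g x p -> path g x q -> sorted g (catrev q (x :: p)).
Proof.
elim: q x p => [|y q IH] x p px //= /andP[gxy pq].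
by apply: IH => //=; rewrite gs gxy.
Qed.

(** Disjointness is tracked by multiplicities: pieces are combined by adding counts, and [uniq] is
    recovered at the end from a bound of 1. *)
Definition mult y q : nat := count_mem y q.

Definition cover_count y Ts : nat := count (fun T => y \in T) Ts.

Arguments mult : simpl never.
Arguments cover_count : simpl never.

Lemma mult_cons y x q : mult y (x :: q) = (x == y) + mult y q.
Proof. by []. Qed.

Lemma mult_cat y q q' : mult y (q ++ q') = mult y q + mult y q'.
Proof. exact: count_cat. Qed.

Lemma mult_rev y q : mult y (rev q) = mult y q.
Proof. exact: count_rev. Qed.

Lemma cover_count_cons y T Ts : cover_count y (T :: Ts) = (y \in T) + cover_count y Ts.
Proof. by []. Qed.

Lemma cover_count_cat y Ts Ts' : cover_count y (Ts ++ Ts') = cover_count y Ts + cover_count y Ts'.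
Proof. exact: count_cat. Qed.

Definition link T a b := exists (x : V) (p : seq V),
  [/\ path g x p, uniq (x :: p), all (mem T) (x :: p), g a x & g (last x p) b].

Lemma mult_le_mem T q y : uniq q -> all (mem T) q -> mult y q <= (y \in T).
Proof.
move=> uq /allP qT; rewrite /mult count_uniq_mem //.
by case: (boolP (y \in q)) => // /qT /= yT; rewrite yT.
Qed.

(** Each vertex of [zs] is reached from the previous one through its own set of [Ts]. A link has at
    least one vertex, so each entry of [zs] contributes at least two vertices. *)
Lemma chain z zs Ts x q : size Ts = size zs ->
  (forall T a b, T \in Ts -> a \in z :: zs -> b \in z :: zs -> link T a b) ->
  g (last z zs) x -> path g x q ->
  exists p : seq V, [/\ path g z p, 2 * size zs + (size q).+1 <= size p &
    forall y, mult y (z :: p) <=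
      mult y (z :: zs) + cover_count y Ts + mult y (x :: q)].
Proof.
elim: zs z Ts => [|z' zs IH] z [|T Ts] // sz hl gx pq.
  exists (x :: q); split=> //=; first by rewrite gx.
  by move=> y; rewrite mult_cons [mult y [:: z]]mult_cons -!addnA leq_add2l addnA leq_addl.
case: (hl T z z'); rewrite ?inE ?eqxx ?orbT // => x0 [p0 [h1 h2 h3 h4 h5]].
case: (IH z' Ts) => //; first by case: sz.
  by move=> U a b UT aZ bZ; apply: hl; rewrite in_cons ?UT ?aZ ?bZ orbT.
move=> p [pp sp cp]; exists (x0 :: p0 ++ z' :: p); split.
- by rewrite /= h4 cat_path h1 /= h5.
- by rewrite /= size_cat /=; clear -sp; lia.
- move=> y; rewrite -cat_cons mult_cons mult_cat [mult y [:: z, z' & zs]]mult_cons cover_count_cons.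
  have := leq_add (mult_le_mem y h2 h3) (cp y); move: (z == y : nat) (y \in T : nat) => i j; clear; lia.
Qed.

(** The chain from [z] is prolonged backwards by [x0 :: q0]; the constant 3 counts [x0], [z] and
    [x]. *)
Lemma zigzag x0 q0 z zs Ts x q : size Ts = size zs ->
  (forall T a b, T \in Ts -> a \in z :: zs -> b \in z :: zs -> link T a b) ->
  path g x0 q0 -> g z x0 -> g (last z zs) x -> path g x q ->
  exists p : seq V, [/\ sorted g p, size q0 + size q + 2 * size zs + 3 <= size p &
    forall y, mult y p <= mult y (x0 :: q0) +
      mult y (z :: zs) + cover_count y Ts + mult y (x :: q)].
Proof.
move=> sz hl p0 gz gx pq; have [p [pp sp cp]] := chain sz hl gx pq.
exists (catrev q0 (x0 :: z :: p)); split.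
- by apply: sorted_catrev => //=; rewrite gs gz.
- by rewrite catrevE size_cat size_rev /=; lia.
- move=> y; rewrite catrevE mult_cat mult_rev !(mult_cons y x0).
  have := cp y; move: (x0 == y : nat) => i; lia.
Qed.

Lemma conn_link T a b x y : conn g T -> x \in T -> y \in T -> g a x -> g b y -> link T a b.
Proof.
move=> cT xT yT gax gby; have /connectP[p pp Ey] := conn_connect cT xT yT.
move: gby; rewrite {}Ey; case/shortenP: pp => p' pp' up' _ gby {p}.
exists x, p'; split=> //; last by rewrite gs.
  by apply: sub_path pp' => u v /and3P[].
rewrite /= xT /=; elim: p' x pp' {up' gby gax xT} => //= u p' IH x /andP[/and3P[_ -> _] h].
exact: IH h.
Qed.

(** A path on at most [d] vertices cannot contain all neighbours of its last vertex, so it can be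
    prolonged. *)
Lemma greedy_path T d x t : (forall y, y \in T -> d <= e2 g [set y] T) -> x \in T -> t <= d ->
  exists q : seq V, [/\ size q = t, path g x q, uniq (x :: q) & all (mem T) (x :: q)].
Proof.
move=> hd xT; elim: t => [|t IH] td; first by exists [::]; rewrite /= xT.
have [q [sq pq uq aq]] := IH (ltnW td).
set b := last x q.
have bT : b \in T by move/allP: aq; apply; exact: mem_last.
have [/existsP[y /and3P[yT gby yq]]|/existsPn nb] :=
  boolP [exists y, [&& y \in T, g b y & y \notin x :: q]].
  exists (rcons q y); split.
  - by rewrite size_rcons sq.
  - by rewrite rcons_path pq.
  - by rewrite -rcons_cons rcons_uniq yq uq.
  - by rewrite -rcons_cons all_rcons aq /= yT.
suff : e2 g [set b] T <= t by have := hd b bT; lia.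
apply: (leq_trans (deg_on_path (q := x :: q) _ uq)).
  by move=> y yT gby; have := nb y; rewrite yT gby /= negbK.
rewrite lastI -cats1 count_cat /= -/b gi !addn0.
by apply: leq_trans (count_size _ _) _; rewrite size_belast sq.
Qed.

(* An entry [(n, k)] of [data] asks for a path on [n] vertices that uses [k]
   vertices of [Z] and at most [k.+1] members of [Ts]. *)
Lemma embed d (data : seq (nat * nat)) Z Ts :
  (forall T, T \in Ts -> conn g T) ->
  (forall T x, T \in Ts -> x \in T -> d <= e2 g [set x] T) ->
  (forall T z, T \in Ts -> z \in Z -> exists2 x, x \in T & g z x) ->
  (forall c, c \in data -> if c.2 is 0
     then forall T, T \in Ts -> exists q, gpath_in g T q /\ size q = c.1
     else c.1 <= 2 * d + 2 * c.2 + 1) ->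
  sumn [seq c.2 | c <- data] <= size Z -> sumn [seq c.2.+1 | c <- data] <= size Ts ->
  exists qs : seq (seq V), [/\ map size qs = map fst data, all (sorted g) qs &
    forall y, mult y (flatten qs) <= mult y Z + cover_count y Ts].
Proof.
elim: data Z Ts => [|[n [|k]] data IH] Z Ts cT dT nT hdata sZ sTs.
- by exists [::].
- case: Ts sTs cT dT nT hdata => [//|T Ts] /= sTs cT dT nT hdata.
  have [q [/and3P[q1 q2 q3] q4]] := hdata (n, 0) (mem_head _ _) T (mem_head _ _).
  case: (IH Z Ts) => //.
  + by move=> U UT; apply: cT; rewrite in_cons UT orbT.
  + by move=> U x UT; apply: dT; rewrite in_cons UT orbT.
  + by move=> U z UT; apply: nT; rewrite in_cons UT orbT.
  + move=> c cd; have := hdata c; rewrite in_cons cd orbT => /(_ isT).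
    by case: (c.2) => // h U UT; apply: h; rewrite in_cons UT orbT.
  + move=> qs [h1 h2 h3]; exists (q :: qs); split=> /=.
    * by rewrite h1 q4.
    * by rewrite q1.
    * move=> y; rewrite mult_cat cover_count_cons.
      have := leq_add (mult_le_mem y q2 q3) (h3 y); move: (y \in T : nat) => i; clear; lia.
(* The sets [T0] and [T1] supply the two tails of [d.+1] vertices, and [k] further sets link the
   [k.+1] vertices of [Z]. This makes [2 * d + 2 * k.+1 + 1] vertices, the bound allowed for [n]. *)
case: Ts sTs cT dT nT hdata => [//|T0 [|T1 Ts]] /= sTs cT dT nT hdata; first by lia.
case: Z sZ nT => [//|z Z] /= sZ nT.
have sk : size (take k Z) = k by rewrite size_takel //; clear -sZ sTs; lia.
have sT : size (take k Ts) = k by rewrite size_takel //; clear -sZ sTs; lia.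
have [x0 x0T gz0] := nT T0 z (mem_head _ _) (mem_head _ _).
have lZ : last z (take k Z) \in z :: Z.
  by have := mem_last z (take k Z); rewrite !in_cons => /predU1P[->|/mem_take->]; rewrite ?eqxx ?orbT.
have T1T : T1 \in [:: T0, T1 & Ts] by rewrite !inE eqxx orbT.
have [x xT gzx] := nT T1 _ T1T lZ.
have [q0 [sq0 pq0 uq0 aq0]] := greedy_path (fun y => dT T0 y (mem_head _ _)) x0T (leqnn d).
have [q [sq pq uq aq]] := greedy_path (fun y => dT T1 y T1T) xT (leqnn d).
have tT U : U \in take k Ts -> U \in [:: T0, T1 & Ts].
  by move=> /mem_take UT; rewrite !in_cons UT !orbT.
have tZ a : a \in z :: take k Z -> a \in z :: Z.
  by rewrite !in_cons => /predU1P[->|/mem_take->]; rewrite ?eqxx ?orbT.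
case: (@zigzag x0 q0 z (take k Z) (take k Ts) x q) => //; first by rewrite sk sT.
  move=> U a b UT aZ bZ.
  have [u uU gau] := nT U a (tT U UT) (tZ a aZ).
  have [v vU gbv] := nT U b (tT U UT) (tZ b bZ).
  exact: (conn_link (cT U (tT U UT)) uU vU gau gbv).
move=> p [so sp cp].
have dTs U : U \in drop k Ts -> U \in [:: T0, T1 & Ts].
  by move=> /mem_drop UT; rewrite !in_cons UT !orbT.
case: (IH (drop k Z) (drop k Ts)).
- by move=> U /dTs; apply: cT.
- by move=> U u /dTs; apply: dT.
- by move=> U u /dTs UT /mem_drop uZ; apply: nT => //; rewrite in_cons uZ orbT.
- move=> c cd; have := hdata c; rewrite in_cons cd orbT => /(_ isT).
  by case: (c.2) => // h U /dTs UT; apply: h.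
- by rewrite size_drop; clear -sZ; lia.
- by rewrite size_drop; clear -sTs; lia.
move=> qs [h1 h2 h3]; exists (take n p :: qs); split=> /=.
- rewrite h1 size_takel //; have := hdata (n, k.+1) (mem_head _ _); rewrite /=.
  by move: sp; rewrite sk sq sq0; clear; lia.
- by rewrite take_sorted.
move=> y; rewrite mult_cat.
have c1 : mult y (take n p) <= mult y p.
  by rewrite -{2}(cat_take_drop n p) mult_cat leq_addr.
have cZ : mult y (z :: Z) = mult y (z :: take k Z) + mult y (drop k Z).
  by rewrite -mult_cat cat_cons cat_take_drop.
have cTs : cover_count y Ts = cover_count y (take k Ts) + cover_count y (drop k Ts).
  by rewrite -cover_count_cat cat_take_drop.
rewrite cZ !cover_count_cons cTs.
have := h3 y; have := leq_trans c1 (cp y).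
have := leq_add (mult_le_mem y uq aq) (mult_le_mem y uq0 aq0).
move: (y \in T0 : nat) (y \in T1 : nat) => i j; clear; lia.
Qed.

End Embedding.

(** * A large complete bipartite subgraph *)

Definition comp_size (c : bool * nat) := if c.1 then 2 * c.2 else (2 * c.2).+1.

Lemma count_le1_uniq (V : eqType) (q : seq V) : (forall y, count_mem y q <= 1) -> uniq q.
Proof.
elim: q => //= x q IH h; apply/andP; split.
  by have := h x; rewrite eqxx add1n ltnS leqn0 -has_pred1 has_count -leqNgt leqn0.
by apply: IH => y; apply: leq_trans (h y); apply: leq_addl.
Qed.

Lemma sumn_subn d (ls : seq nat) : sumn [seq l - d | l <- ls] <= sumn ls - d.
Proof. by elim: ls => //= a ls IH; lia. Qed.

(** With two positive entries, lowering every entry by [d] saves strictly more than [d] in total;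
    the extra unit pays for the difference between [ell s] and [ell s - 1]. *)
Lemma sumn_subn_lt d (ls : seq nat) : 0 < d < sumn ls -> 1 < size ls -> all (leq 1) ls ->
  sumn [seq l - d | l <- ls] + d < sumn ls.
Proof.
case: ls => [|a [|b ls]] //= hd _ /and3P[a1 b1 _].
have := sumn_subn d (b :: ls); rewrite /= in hd *; lia.
Qed.

Lemma sumn_map_lt (I : eqType) (s : seq I) (f f' : I -> nat) : (forall c, f c <= f' c) ->
  (exists2 c, c \in s & f c < f' c) -> sumn (map f s) < sumn (map f' s).
Proof.
move=> hf [c]; elim: s => //= a s IH; have hl : sumn (map f s) <= sumn (map f' s).
  by elim: s {IH} => //= b s IH; have := hf b; lia.
by have := hf a; rewrite in_cons => ha /predU1P[<-|/IH h /h {h}]; clear -ha hl; lia.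
Qed.

(** An upper bound on the number of connected sets that [embed] consumes when a component takes at
    most [c.2] vertices of [Z]. *)
Definition slack (s : seq (bool * nat)) := sumn [seq c.2.+1 | c <- s].

Lemma sumn_le_slack (s : seq (bool * nat)) f : (forall c, f c <= c.2) ->
  sumn [seq (f c).+1 | c <- s] <= slack s.
Proof. by move=> hf; rewrite /slack; elim: s => //= c s IH; have := hf c; lia. Qed.

Lemma comp_size_le c : comp_size c <= 2 * c.2 + 1.
Proof. by rewrite /comp_size; case: c.1; lia. Qed.

(** The threshold of [dense_core] for [m = ell s - 1] and a core large enough to start the search
    [comb] at depth [h]. *)
Definition size_bound K (s : seq (bool * nat)) :=
  let h := sumn (lf_sizes s) in
  (2 * comb_bound h (K + slack s) h ^ 2 + 4 * (ell s - 1) ^ 2).+1.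

Section Structure.
Variables (V : finType) (g : rel V).
Hypotheses (gs : symmetric g) (gi : irreflexive g).
Implicit Types (X Y A B C U T W S : {set V}) (q p Z zs : seq V) (x y z a b : V).

Lemma cover_count_enum (Ts : {set {set V}}) y : trivIset Ts ->
  cover_count y (enum Ts) <= (y \in cover Ts).
Proof.
move=> tT; rewrite /cover_count -size_filter.
have [/bigcupP[T TT yT]|nT] := boolP (y \in cover Ts).
  apply: (@uniq_leq_size _ _ [:: T]); first by rewrite filter_uniq // enum_uniq.
  move=> U; rewrite mem_filter mem_enum inE => /andP[yU UT].
  by rewrite -(def_pblock tT UT yU) (def_pblock tT TT yT).
rewrite leqn0 size_eq0 -(negbK (_ == _)) -has_filter; apply/hasPn => T.
by rewrite mem_enum => TT; apply: contra nT => yT; apply/bigcupP; exists T.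
Qed.

(** The function [f] allots vertices of [B] to the components. Since the sets are disjoint from each
    other and from [B], every multiplicity is at most 1. *)
Lemma embed_sets d (s : seq (bool * nat)) (f : bool * nat -> nat) B (Ts : {set {set V}}) :
  trivIset Ts ->
  (forall T, T \in Ts -> [/\ [disjoint T & B], conn g T,
     forall x, x \in T -> d <= e2 g [set x] T &
     forall z, z \in B -> exists2 x, x \in T & g z x]) ->
  (forall c : bool * nat, c \in s -> if f c is 0
     then forall T, T \in Ts -> exists q, gpath_in g T q /\ size q = comp_size c
     else comp_size c <= 2 * d + 2 * f c + 1) ->
  sumn [seq f c | c <- s] <= #|B| -> sumn [seq (f c).+1 | c <- s] <= #|Ts| ->
  exists qs : seq (seq V), [/\ map size qs = map comp_size s, all (sorted g) qs,
    uniq (flatten qs) & {subset flatten qs <= B :|: cover Ts}].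
Proof.
move=> tT hT hf sB sT.
have [|||||| qs [h1 h2 h3]] := @embed V g gs gi d [seq (comp_size c, f c) | c <- s] (enum B) (enum Ts).
- by move=> T; rewrite mem_enum => /hT[].
- by move=> T x; rewrite mem_enum => /hT[_ _ h _]; apply: h.
- by move=> T z; rewrite !mem_enum => /hT[_ _ _ h]; apply: h.
- move=> _ /mapP[c cs ->] /=; have := hf c cs; case: (f c) => // h T.
  by rewrite mem_enum; apply: h.
- by rewrite -map_comp -cardE.
- by rewrite -map_comp -cardE.
have {}h3 y : mult y (flatten qs) <= (y \in B) + (y \in cover Ts).
  apply: leq_trans (h3 y) _; apply: leq_add; last exact: cover_count_enum.
  by rewrite /mult count_uniq_mem ?enum_uniq // mem_enum.
exists qs; split=> //; first by rewrite h1 -map_comp.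
  apply: count_le1_uniq => y; apply: leq_trans (h3 y) _.
  have [/bigcupP[T TT yT]|] := boolP (y \in cover Ts); last by case: (y \in B).
  by have [dT _ _ _] := hT T TT; rewrite (disjointFr dT yT).
move=> y yq; rewrite inE; have := h3 y; rewrite -has_pred1 has_count in yq.
by case: (y \in B); case: (y \in cover Ts) => //=; rewrite leqNgt yq.
Qed.

Lemma embed_linear d (s : seq (bool * nat)) (f : bool * nat -> nat) B (Ts : {set {set V}}) :
  trivIset Ts ->
  (forall T, T \in Ts -> [/\ [disjoint T & B], conn g T,
     forall x, x \in T -> d <= e2 g [set x] T &
     forall z, z \in B -> exists2 x, x \in T & g z x]) ->
  (forall c : bool * nat, c \in s -> if f c is 0
     then forall T, T \in Ts -> exists q, gpath_in g T q /\ size q = comp_size c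
     else comp_size c <= 2 * d + 2 * f c + 1) ->
  sumn [seq f c | c <- s] <= #|B| -> sumn [seq (f c).+1 | c <- s] <= #|Ts| ->
  linear_in g (lf_sizes s).
Proof.
move=> tT hT hf sB sT; have [qs [h1 h2 h3 _]] := embed_sets tT hT hf sB sT.
by exists qs; split.
Qed.

Lemma gpath_take T q n : gpath_in g T q -> gpath_in g T (take n q).
Proof.
case/and3P=> h1 h2 h3; apply/and3P; split; rewrite ?take_sorted ?take_uniq //.
by apply/allP => x /mem_take; apply: (allP h3).
Qed.

Lemma conn_mindeg T x : conn g T -> x \in T -> #|T| != 1 -> 0 < e2 g [set x] T.
Proof.
move=> cT xT T1; rewrite lt0n; apply/eqP => e0; case/negP: (cT [set x]); apply/and3P; split.
- by apply/set0Pn; exists x; rewrite inE.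
- rewrite properEcard sub1set xT cards1 ltn_neqAle eq_sym T1 card_gt0.
  by apply/set0Pn; exists x.
apply/forall_inP => z; rewrite inE => /eqP ->; apply/forall_inP => y; rewrite !inE => /andP[_ yT].
move: e0; rewrite e21 => /eqP; rewrite cards_eq0 => /eqP/setP/(_ y).
by rewrite !inE yT /= => ->.
Qed.

Lemma dense_structure (s : seq (bool * nat)) K :
  1 < size s -> (forall c : bool * nat, c \in s -> 0 < c.2) -> (exists2 c : bool * nat, c \in s & 1 < c.2) ->
  size_bound K s <= #|V| ->
  2 * (ell s - 1) * (#|V| - (ell s - 1)) <= e2 g setT setT ->
  ~ linear_in g (lf_sizes s) ->
  exists S C, [/\ #|S| = ell s - 1, K <= #|C| & forall x y, x \in S -> y \in C -> g x y].
Proof.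
move=> ss sp hk hV hE nH.
set m := ell s - 1 in hE *.
set h := sumn (lf_sizes s).
have ell2 : 2 <= ell s.
  have [c cs c2] := hk; rewrite /ell; elim: s cs {ss sp hk hV hE nH m h} => //= a s IH.
  by rewrite in_cons => /predU1P[<-|/IH h]; [apply: ltn_addr | apply: ltn_addl].
have m0 : 0 < m by rewrite /m; clear -ell2; lia.
have [W [cW hW]] := dense_core m0 hE hV.
have noP q : sorted g q -> uniq q -> size q < h.
  move=> sq uq; rewrite ltnNge; apply/negP => hq; apply: nH.
  by apply: (@path_linear _ _ _ (take h q)); rewrite ?take_sorted ?take_uniq // size_takel.
have slack0 : 0 < slack s by rewrite /slack; case: (s) ss => //= c s' _; clear; lia.
(* The search starts with an empty stack. Asking for [K + slack s] sets guarantees either [K]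
   singletons or [slack s] larger sets. *)
have [||||B [Ts [cTs tTs hTs]]] :=
    @comb V g gs W h (K + slack s) h [::] W _ isT isT _ (subxx _) _ _ (add0n h) cW noP.
- by clear -slack0; lia.
- by [].
- by move=> x y _ ->.
- by [].
have hB T z : T \in Ts -> z \in B -> exists2 x, x \in T & g z x.
  move=> /hTs[_ _ _ <-]; rewrite !inE => /andP[_ /exists_inP[x xT gxz]].
  by exists x; rewrite // gs.
have dB T : T \in Ts -> [disjoint T & B].
  move=> /hTs[_ _ _ <-]; rewrite disjoint_subset; apply/subsetP=> x xT.
  by rewrite !inE xT.
(* With [ell s] vertices in [B], plain zigzags ([d = 0]) through [c.2] of them realise every
   component. *)
have [large|] := leqP (ell s) #|B|.
  exfalso; apply: nH; apply: (@embed_linear 0 s snd B Ts) => //.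
  - move=> T TT; have [_ _ cT _] := hTs T TT; split=> //; first exact: dB.
    by move=> z; apply: hB.
  - move=> c cs; have := sp c cs; have := comp_size_le c; case: (c.2) => // k; clear; lia.
  - by rewrite -/(slack s); clear -cTs; lia.
move=> pl; have {pl} : #|B| <= m by rewrite /m; clear -pl; lia.
rewrite leq_eqVlt => /predU1P[Bm|Bm].
  pose Ts1 := [set T in Ts | #|T| == 1].
  have [K1|K1] := leqP K #|Ts1|.
    exists B, (cover Ts1); split=> //.
      have tT1 : trivIset Ts1 by apply: trivIsetS tTs; apply/subsetP=> T; rewrite inE => /andP[].
      rewrite -(eqP tT1); apply: leq_trans K1 _; rewrite -sum1_card; apply: leq_sum => T.
      by rewrite inE => /andP[_ /eqP->].
    move=> x y xB /bigcupP[T]; rewrite inE => /andP[TT /cards1P[w Ew]] yT.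
    have [w' w'T gxw] := hB T x TT xB.
    by move: yT w'T gxw; rewrite Ew !inE => /eqP-> /eqP->.
  exfalso; apply: nH.
  (* A connected set with at least two vertices has minimum degree 1, so a zigzag gains a vertex at
     each end and a component with [1 < c.2] saves a vertex of [B]. One such component lowers the
     demand to [m]. For [c.2 = 1] the value stays 1, as 0 would require a path inside a single
     set. *)
  pose f (c : bool * nat) := if 1 < c.2 then c.2.-1 else c.2.
  have ff c : f c <= c.2 by rewrite /f; case: ifP => // _; apply: leq_pred.
  apply: (@embed_linear 1 s f B (Ts :\: Ts1)) => //.
  - by apply: trivIsetS tTs; apply: subsetDl.
  - move=> T; rewrite !inE => /andP[nT TT]; rewrite TT /= in nT.
    have [_ _ cT _] := hTs T TT; split=> //; first exact: dB.
      by move=> x xT; apply: conn_mindeg.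
    by move=> z; apply: hB.
  - move=> c cs; have := sp c cs; have := comp_size_le c; rewrite /f.
    by case: (c.2) => [|[|k]] //=; clear; lia.
  - rewrite Bm /m.
    have : sumn [seq f c | c <- s] < ell s.
      apply: sumn_map_lt => //; have [c cs c2] := hk; exists c => //.
      by rewrite /f c2; case: (c.2) c2.
    clear; lia.
  - have := cardsID Ts1 Ts; have := sumn_le_slack s ff.
    have := subset_leq_card (subsetIr Ts Ts1); clear -K1 cTs; lia.
(* Each set now has minimum degree [d] and contains a path on [2 * d + 1] vertices. Components with
   [c.2 <= d] fit inside one set; the others need only [c.2 - d] vertices of [B], and [sumn_subn_lt]
   bounds the total demand by [#|B|]. *)
exfalso; apply: nH; pose d := m - #|B|.
apply: (@embed_linear d s (fun c => c.2 - d) B Ts) => //.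
- move=> T TT; have [TW _ cT nbT] := hTs T TT; split=> //; first exact: dB.
    by move=> x xT; have := core_mindeg gs gi hW TW xT; rewrite nbT /d; clear; lia.
  by move=> z; apply: hB.
- move=> c cs; case E: (c.2 - d) => [|k]; last first.
    by apply: leq_trans (comp_size_le c) _; clear -E; lia.
  move=> T TT; have [TW T0 cT nbT] := hTs T TT.
  have [|q [gq sq]] := @dense_path V g gs gi T d.
    by rewrite /d -nbT; apply: (core_density gs hW) => //; rewrite nbT.
  exists (take (comp_size c) q); split; first exact: gpath_take.
  by rewrite size_takel // sq; apply: leq_trans (comp_size_le c) _; clear -E; lia.
- have := @sumn_subn_lt d [seq c.2 | c <- s]; rewrite -/(ell s) size_map -map_comp => H.
  have {}H : sumn [seq c.2 - d | c <- s] + d < ell s.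
    apply: H => //; first by rewrite /d /m; clear -Bm ell2 m0; lia.
    by rewrite all_map; apply/allP => c /sp.
  by rewrite /d /m in H Bm *; clear -H Bm; lia.
- by apply: leq_trans (sumn_le_slack _ _) _; [move=> c; apply: leq_subr | clear -cTs; lia].
Qed.

End Structure.

(** * Counting the edges around the core *)

Section AroundCore.
Variables (V : finType) (g : rel V).
Hypotheses (gs : symmetric g) (gi : irreflexive g).
Implicit Types (X Y A B C U T W S : {set V}) (q p Z zs : seq V) (x y z a b u v : V).

Lemma conn1 x : conn g [set x].
Proof.
move=> X; apply/negP=> /and3P[X0 /proper_card]; rewrite cards1 ltnS leqn0 cards_eq0.
by rewrite (negbTE X0).
Qed.

(** * Paths forbidden around a set [S] that is completely joined to a large set [C] *)

Section Core.
Variables (s : seq (bool * nat)) (S C : {set V}).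
Hypotheses (sp : forall c : bool * nat, c \in s -> 0 < c.2)
  (cS : #|S| = ell s - 1) (SC : forall x y, x \in S -> y \in C -> g x y)
  (cC : slack s + sumn (lf_sizes s) + 3 <= #|C|) (nH : ~ linear_in g (lf_sizes s)).

Lemma core_disjoint x : x \in C -> x \notin S.
Proof. by move=> xC; apply/negP=> xS; have := SC xS xC; rewrite gi. Qed.

(** Otherwise such a path serves as the component [c] and leaves at least [ell s - c.2] vertices of
    [S], enough for zigzags through [C] that realise all other components. *)
Lemma short_component s1 c s2 q : s = s1 ++ c :: s2 -> sorted g q -> uniq q ->
  comp_size c <= size q -> c.2 <= #|S :&: [set x in q]|.
Proof.
move=> Es so uq sq; rewrite leqNgt; apply/negP=> qS; apply: nH.
pose q' := take (comp_size c) q; pose X := [set x in q'].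
have sq' : size q' = comp_size c by rewrite size_takel.
have uq' : uniq q' by rewrite take_uniq.
have cX : #|X| = comp_size c by rewrite cardsE (card_uniqP uq') sq'.
have SX : #|S :&: X| < c.2.
  apply: leq_ltn_trans qS; apply: subset_leq_card; apply: setIS.
  by apply/subsetP=> x; rewrite !inE => /mem_take.
have Esz : map comp_size s = map comp_size s1 ++ comp_size c :: map comp_size s2.
  by rewrite Es map_cat.
have hc : comp_size c <= sumn (lf_sizes s).
  by rewrite [lf_sizes s]Esz sumn_cat /=; clear; lia.
have hsl : sumn [seq c.2.+1 | c <- s1 ++ s2] <= slack s.
  by rewrite /slack Es !map_cat !sumn_cat /=; clear; lia.
have hell : ell s = sumn [seq c.2 | c <- s1 ++ s2] + c.2.
  by rewrite /ell Es !map_cat !sumn_cat /=; clear; lia.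
pose Ts := [set [set w] | w in C :\: X].
have cTs : #|Ts| = #|C :\: X| by rewrite card_imset //; apply: set1_inj.
have [|||||qs [h1 h2 h3 h4]] := @embed_sets V g gs gi 0 (s1 ++ s2) snd (S :\: X) Ts.
- apply/trivIsetP=> _ _ /imsetP[w _ ->] /imsetP[w' _ ->] ne.
  by rewrite disjoints1 inE; apply: contraNneq ne => ->.
- move=> T /imsetP[w]; rewrite inE => /andP[wX wC] -> {T}; split=> //.
  + by rewrite disjoints1 !inE negb_and (core_disjoint wC) orbT.
  + exact: conn1.
  + by move=> z; rewrite inE => /andP[_ zS]; exists w; rewrite ?inE // SC.
- move=> c' c's; have : 0 < c'.2 by apply: sp; rewrite Es mem_cat in_cons orbCA -mem_cat c's orbT.
  by have := comp_size_le c'; case: (c'.2) => //= k; clear; lia.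
- by have := cardsID X S; clear -SX hell cS; lia.
- rewrite cTs; have := cardsID X C; have := subset_leq_card (subsetIr C X).
  by clear -cX hsl hc cC; lia.
pose k := size s1.
exists (take k qs ++ q' :: drop k qs); split.
- rewrite map_cat /= map_take map_drop h1 map_cat [RHS]Esz sq'.
  by rewrite take_size_cat ?drop_size_cat ?size_map.
- by move: h2; rewrite -{1}(cat_take_drop k qs) !all_cat /= take_sorted.
have pe : perm_eq (flatten (take k qs ++ q' :: drop k qs)) (q' ++ flatten qs).
  by rewrite flatten_cat /= perm_catCA perm_cat2l -flatten_cat cat_take_drop.
rewrite (perm_uniq pe) cat_uniq uq' h3 andbT /=; apply/hasPn=> y /h4; rewrite !inE.
case/orP=> [/andP[]//|/bigcupP[_ /imsetP[w wC ->]]]; rewrite inE => /eqP->.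
by move: wC; rewrite !inE => /andP[].
Qed.

(** A zigzag between [S] and [C] with prescribed tails. It leaves [S] towards [x0] at [z], so only
    [z] has to be adjacent to [x0]; the vertex of [S] next to [x] is not prescribed, hence [x] is
    joined to all of [S]. *)
Lemma alternate k z x0 q0 x q : z \in S -> 0 < k <= #|S| -> g z x0 ->
  path g x0 q0 -> path g x q -> (forall z', z' \in S -> g z' x) ->
  uniq ((x0 :: q0) ++ (x :: q)) -> {in (x0 :: q0) ++ (x :: q), forall y, y \notin S} ->
  size ((x0 :: q0) ++ (x :: q)) + k <= #|C| ->
  exists p : seq V, [/\ sorted g p, uniq p, size q0 + size q + 2 * k + 1 <= size p &
    #|S :&: [set y in p]| <= k].
Proof.
move=> zS kS gz p0 p1 hx uq nS hC.
pose zs := take k.-1 (enum (S :\ z)); pose X := [set y in (x0 :: q0) ++ (x :: q)].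
pose ws := take k.-1 (enum (C :\: X)).
have szs : size zs = k.-1.
  rewrite size_takel // -cardE; have := cardsD1 z S; rewrite zS; clear -kS; lia.
have sws : size ws = k.-1.
  rewrite size_takel // -cardE; have := cardsID X C; have := subset_leq_card (subsetIr C X).
  have : #|X| = size ((x0 :: q0) ++ (x :: q)) by rewrite cardsE; apply/card_uniqP.
  by clear -kS hC; lia.
have uzs : uniq (z :: zs).
  rewrite /= take_uniq ?enum_uniq // andbT; apply/negP=> /mem_take.
  by rewrite mem_enum !inE eqxx.
have zsS y : y \in z :: zs -> y \in S.
  by rewrite inE => /predU1P[->//|/mem_take]; rewrite mem_enum !inE => /andP[].
have wsP y : y \in ws -> y \in C /\ y \notin (x0 :: q0) ++ (x :: q).
  by move=> /mem_take; rewrite mem_enum !inE => /andP[].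
have uws : uniq ws by rewrite take_uniq ?enum_uniq.
have [||||||p [so szp cp]] := @zigzag V g gs x0 q0 z zs [seq [set w] | w <- ws] x q.
- by rewrite size_map sws szs.
- move=> _ a b /mapP[w /wsP[wC _] ->] /zsS aS /zsS bS; exists w, [::].
  by split; rewrite //= ?inE ?eqxx //; [exact: SC | rewrite gs; exact: SC].
- exact: p0.
- exact: gz.
- by apply: hx; apply: zsS; apply: mem_last.
- exact: p1.
have cov y : cover_count y [seq [set w] | w <- ws] = (y \in ws).
  rewrite /cover_count count_map -(count_uniq_mem y uws); apply: eq_count => w /=.
  by rewrite inE eq_sym.
have {}cp y : mult y p <= (y \in (x0 :: q0) ++ (x :: q)) + (y \in z :: zs) + (y \in ws).
  apply: leq_trans (cp y) _; rewrite cov -(count_uniq_mem y uq) -(count_uniq_mem y uzs).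
  by rewrite count_cat /mult; clear; lia.
exists p; split=> //.
- apply: count_le1_uniq => y; apply: leq_trans (cp y) _.
  have [/[dup]/nS yS yq|yq] := boolP (y \in (x0 :: q0) ++ (x :: q)).
    have -> : (y \in z :: zs) = false by apply: contraNF yS => /zsS.
    by have -> : (y \in ws) = false by apply/negP=> /wsP[_]; rewrite yq.
  have [/wsP[yC _]|] := boolP (y \in ws); last by case: (y \in z :: zs).
  by have -> : (y \in z :: zs) = false by apply: contraNF (core_disjoint yC) => /zsS.
- by move: szp; rewrite szs; clear -kS; lia.
- have -> : k = size (z :: zs) by rewrite /= szs; clear -kS; lia.
  rewrite -(card_uniqP uzs); apply: subset_leq_card; apply/subsetP=> y; rewrite !inE.
  case/andP=> yS yp; have := cp y; rewrite -has_pred1 has_count in yp.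
  have -> : (y \in (x0 :: q0) ++ (x :: q)) = false by apply/negP=> /nS; rewrite yS.
  have -> : (y \in ws) = false by apply/negP=> /wsP[/core_disjoint]; rewrite yS.
  rewrite addn0 add0n in_cons; case: (_ || _) => //.
  by rewrite leqn0 => /eqP y0; move: yp; rewrite -/(mult y p) y0.
Qed.

Lemma component_split (c : bool * nat) : c \in s ->
  [/\ exists s1 s2, s = s1 ++ c :: s2, c.2 <= ell s & c.2 < slack s].
Proof.
case/splitPr=> s1 s2; split; first by exists s1, s2.
- by rewrite /ell map_cat sumn_cat /=; clear; lia.
- by rewrite /slack map_cat sumn_cat /=; clear; lia.
Qed.

(** Using only [c.2.-1] vertices of [S], the zigzag has [2 * c.2 - 1] vertices plus the lengths of
    [q0] and [q]. One extra vertex completes an even component and two complete an odd one, against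
    [short_component]. *)
Lemma no_alternating (c : bool * nat) z x0 q0 x q : c \in s -> 1 < c.2 -> z \in S -> g z x0 ->
  path g x0 q0 -> path g x q -> (forall z', z' \in S -> g z' x) ->
  uniq ((x0 :: q0) ++ (x :: q)) -> {in (x0 :: q0) ++ (x :: q), forall y, y \notin S} ->
  size q0 + size q <= 2 -> (if c.1 then 1 else 2) <= size q0 + size q -> False.
Proof.
move=> cs c2 zS gz p0 p1 hx uq nS le2 hc.
have [[s1 [s2 Es]] cl csl] := component_split cs.
have [||p [so up sz pS]] := @alternate c.2.-1 z x0 q0 x q zS _ gz p0 p1 hx uq nS.
- by rewrite cS; clear -c2 cl; lia.
- by rewrite size_cat /=; clear -le2 c2 csl cC; lia.
suff /(short_component Es so up) : comp_size c <= size p by clear -pS c2; lia.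
by rewrite /comp_size; case: (c.1) hc => hc; clear -sz hc c2; lia.
Qed.

Lemma fresh_core (q : seq V) : size q <= 3 -> exists2 x, x \in C & x \notin q.
Proof.
move=> sq; have [/existsP[x /andP[]]|/existsPn h] := boolP [exists x, (x \in C) && (x \notin q)].
  by exists x.
have hq : #|C| <= size q; last first.
  (* An empty [s] would be trivially embedded, contradicting [nH]; a nonempty one makes [C] strictly
     larger than 3. *)
  exfalso; move: nH cC; case: (s) => [[]|c s' _]; first by exists [::].
  by rewrite /slack /=; clear -sq hq; lia.
rewrite cardE; apply: uniq_leq_size; rewrite ?enum_uniq // => x.
by rewrite mem_enum => xC; have := h x; rewrite xC negbK.
Qed.

(** The tail [v, y], or [v, y, x], is joined to a zigzag whose other end is a fresh vertex [w] of
    [C]. An even component thus excludes edges outside [S] at vertices attached to [S]; an odd one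
    leaves [v] as the only neighbour of [y] outside [S]. *)
Lemma attached_path v y x (c : bool * nat) z : c \in s -> 1 < c.2 -> z \in S -> g z v ->
  [/\ v \notin S, y \notin S & x \notin S] -> g v y ->
  if c.1 then False else g y x -> x = v.
Proof.
move=> cs c2 zS gzv [vS yS xS] gvy.
have vy : v != y by apply: contraTneq gvy => ->; rewrite gi.
have [w wC] := @fresh_core [:: v; y; x] isT; rewrite !inE !negb_or => /and3P[wv wy wx].
have hw z' : z' \in S -> g z' w by move=> z'S; apply: SC.
have wS := core_disjoint wC.
case E: c.1.
  apply: (@no_alternating c z v [:: y] w [::] cs c2 zS gzv) => //=; rewrite ?E ?gvy //.
    by rewrite !inE !negb_or vy ![_ == w]eq_sym wv wy.
  by move=> a; rewrite !inE => /or3P[] /eqP->.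
move=> gyx; apply/eqP/negPn/negP => xv.
have yx : y != x by apply: contraTneq gyx => ->; rewrite gi.
apply: (@no_alternating c z v [:: y; x] w [::] cs c2 zS gzv) => //=; rewrite ?E ?gvy ?gyx //.
  by rewrite !inE !negb_or vy yx ![_ == w]eq_sym wv wy wx (eq_sym v x) xv.
by move=> a; rewrite !inE => /or4P[] /eqP->.
Qed.

(** A zigzag prolonged by one edge at each end gains two vertices, enough for either parity. *)
Lemma two_edges v u v' u' (c : bool * nat) : c \in s -> 1 < c.2 ->
  (forall z, z \in S -> g z v) -> (forall z, z \in S -> g z v') ->
  g v u -> g v' u' -> uniq [:: v; u; v'; u'] -> {in [:: v; u; v'; u'], forall y, y \notin S} -> False.
Proof.
move=> cs c2 fv fv' gvu gvu' uq nS.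
have [z zS] : exists z, z \in S.
  apply/card_gt0P; rewrite cS; have [_ h _] := component_split cs; clear -h c2; lia.
apply: (@no_alternating c z v [:: u] v' [:: u'] cs c2 zS) => //=; rewrite ?fv ?gvu ?gvu' //.
by case: c.1.
Qed.

(** A path avoiding [S] is too short for the first component, so Erdos-Gallai bounds the edges; the
    second component gives [c.2 <= ell s - 1]. *)
Lemma sparse_outside (U : {set V}) : 1 < size s -> U \subset ~: S ->
  e2 g U U <= 2 * (ell s - 1) * #|U|.
Proof.
move=> ss US; rewrite leqNgt; apply/negP => dU.
case: (s) (component_split) ss dU cS (short_component) (sp) => [//|c [//|c' s']] _ _ dU _ hshort hp.
have [|q [gq sq]] := @dense_path V g gs gi U c.2.
  apply: leq_ltn_trans dU; apply: leq_mul => //.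
  have := hp c' _; rewrite !inE eqxx orbT => /(_ isT).
  by rewrite /ell /=; clear; lia.
have /and3P[q1 q2 /allP q3] := gq.
have := hshort [::] c (c' :: s') q erefl q1 q2; rewrite sq => /(_ _).
have -> : S :&: [set x in q] = set0.
  apply/setP=> x; rewrite !inE; apply/negP=> /andP[xS /q3 xU].
  by have := subsetP US _ xU; rewrite inE xS.
rewrite cards0 leqn0 => H; have := hp c (mem_head _ _); rewrite lt0n => /negP[].
by apply: H; have := comp_size_le c; rewrite addn1.
Qed.

End Core.

(** Outside [S], let [A] be the vertices attached to [S] and [U] the others. Edges inside [A] form a
    matching; each is charged to a missing pair between one of its ends and [S], except those with
    both ends joined to all of [S], which [D] bounds. The edges meeting [U] number at most
    [#|S| * #|U|]. *)
Lemma edge_bound S D : 0 < #|S| -> e2 g S S = 0 ->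
  (forall v y x z, z \in S -> g z v -> [/\ v \notin S, y \notin S & x \notin S] ->
     g v y -> g y x -> x = v) ->
  (forall U, U \subset ~: S -> e2 g U U <= 2 * #|S| * #|U|) ->
  #|[set p : V * V | [&& p.1 \notin S, p.2 \notin S, g p.1 p.2 &
      [forall z in S, g z p.1 && g z p.2]]]| <= 2 * D ->
  e2 g setT setT <= 2 * #|S| * (#|V| - #|S|) + 2 * D.
Proof.
move=> S0 eS hP hU hfull.
pose R := ~: S; pose A := [set x in R | [exists z in S, g z x]]; pose U := R :\: A.
have AR : A \subset R by apply/subsetP=> x; rewrite inE => /andP[].
have P3 v y x : v \in A -> y \in R -> x \in R -> g v y -> g y x -> x = v.
  rewrite !inE => /andP[vS /exists_inP[z zS gz]] yS xS; exact: (hP v y x z).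
have cR : #|A| + #|U| = #|V| - #|S|.
  have := cardsC S; have := cardsID A R; rewrite (setIidPr AR) -/R -/U; clear; lia.
have USle : e2 g U S = 0.
  apply: big1 => x xU; apply: big1 => z zS; apply/eqP; rewrite eqb0.
  move: xU; rewrite !inE => /andP[+ xS]; rewrite xS /= => /exists_inPn/(_ z zS).
  by rewrite gs.
have -> : e2 g setT setT = 2 * e2 g A S + (e2 g A A + 2 * e2 g U A + e2 g U U).
  rewrite (e2_split gs (subsetT S)) eS setTD -/R (e2_split gs AR) (e2_sym gs S R).
  rewrite (e2_splitl _ _ AR) -/U USle (e2_sym gs U A); clear; lia.
have deg1 x : x \in A -> forall y, y \in R -> g x y -> e2 g [set y] R <= 1.
  move=> xA y yR gxy; rewrite e21 -(cards1 x); apply: subset_leq_card; apply/subsetP=> y'.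
  rewrite !inE => /andP[y'R gyy']; apply/eqP; apply: (P3 x y y') => //.
  by rewrite inE.
have le_nbr x Y : e2 g [set x] (Y :&: R) <= e2 g [set x] R.
  by rewrite (e2_splitr gs _ (subsetIr Y R)) leq_addr.
have boundU : 2 * e2 g U A + e2 g U U <= 2 * #|S| * #|U|.
  (* A vertex of [L] has a single neighbour outside [S], and it lies in [A]. So [L] contributes at
     most one edge per vertex, and edges inside [U] avoid [L]. *)
  pose L := [set y in U | [exists x in A, g x y]].
  have LU : L \subset U by apply/subsetP=> y; rewrite inE => /andP[].
  have LA : e2 g L A <= 1 * #|L|.
    apply: e2_leP => y; rewrite inE => /andP[yU /exists_inP[x xA gxy]].
    have yR : y \in R by move: yU; rewrite inE => /andP[].
    by apply: leq_trans (deg1 x xA y yR gxy); rewrite -{1}(setIidPl AR) le_nbr.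
  have ULA : e2 g (U :\: L) A = 0.
    apply: big1 => y yUL; apply: big1 => x xA; apply/eqP; rewrite eqb0.
    move: yUL; rewrite !inE negb_and => /andP[+ yU]; rewrite yU /= => /exists_inPn/(_ x xA).
    by rewrite gs.
  have LU0 y x : y \in L -> x \in U -> ~~ g y x.
    rewrite inE => /andP[yU /exists_inP[v vA gvy]] xU; apply/negP=> gyx.
    have xv : x = v.
      by apply: (P3 v y x) => //; [move: yU | move: xU]; rewrite inE => /andP[].
    by move: xU; rewrite xv inE vA.
  have EU : e2 g U U = e2 g (U :\: L) (U :\: L).
    rewrite (e2_split gs LU).
    have -> : e2 g L L = 0.
      apply: big1 => y yL; apply: big1 => x xL; apply/eqP; rewrite eqb0.
      by apply: LU0 => //; apply: (subsetP LU).
    suff -> : e2 g L (U :\: L) = 0 by [].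
    apply: big1 => y yL; apply: big1 => x; rewrite inE => /andP[_ xU]; apply/eqP; rewrite eqb0.
    exact: LU0.
  have hUL : e2 g (U :\: L) (U :\: L) <= 2 * #|S| * #|U :\: L|.
    by apply: hU; apply: subset_trans (subsetDl _ _) _; apply: subsetDl.
  have cU : #|U| = #|L| + #|U :\: L| by rewrite -(cardsID L U) (setIidPr LU).
  rewrite EU (e2_splitl _ _ LU) ULA cU; clear -LA hUL S0; nia.
pose miss x := #|S| - e2 g [set x] S.
have leS x : e2 g [set x] S <= #|S| by have := e2_le g [set x] S; rewrite cards1 mul1n.
have missP x z : z \in S -> ~~ g z x -> 0 < miss x.
  move=> zS ngzx; rewrite subn_gt0 e21; apply: proper_card; apply/properP; split.
    by apply/subsetP=> y; rewrite inE => /andP[].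
  by exists z; rewrite // inE gs (negbTE ngzx) andbF.
pose fp x y := [&& x \notin S, y \notin S, g x y & [forall z in S, g z x && g z y]].
have ptw x y : x \in A -> y \in A ->
    (g x y : nat) <= g x y * miss x + g x y * miss y + fp x y.
  move=> xA yA; have [gxy|//] := boolP (g x y); rewrite !mul1n /fp gxy.
  have xS : x \notin S by move: (subsetP AR _ xA); rewrite inE.
  have yS : y \notin S by move: (subsetP AR _ yA); rewrite inE.
  rewrite xS yS /=; have [_|] := boolP [forall z in S, g z x && g z y]; first by rewrite addn1.
  move/forall_inPn=> [z zS].
  by rewrite negb_and => /orP[] /(missP _ _ zS); clear; lia.
have boundA : e2 g A A <= 2 * \sum_(x in A) miss x + 2 * D.
  (* A vertex of [A] has at most one neighbour in [A], so its missing pairs are charged at most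
     once. *)
  have E1 : \sum_(x in A) \sum_(y in A) g x y * miss x <= \sum_(x in A) miss x.
    apply: leq_sum => x xA; rewrite -big_distrl /= -[X in _ <= X]mul1n leq_mul2r.
    apply/orP; right.
    have [/exists_inP[y yA gxy]|/exists_inPn h] := boolP [exists y in A, g x y].
      have := deg1 y yA x (subsetP AR _ xA); rewrite gs gxy => /(_ isT).
      apply: leq_trans; have := le_nbr x A; rewrite (setIidPl AR) {1}/e2 big_set1; exact.
    by rewrite big1 // => y yA; rewrite (negbTE (h y yA)).
  have E2 : \sum_(x in A) \sum_(y in A) g x y * miss y <= \sum_(x in A) miss x.
    rewrite exchange_big /=; apply: leq_trans E1; apply: leq_sum => x _.
    by apply: leq_sum => y _; rewrite gs.
  have E3 : \sum_(x in A) \sum_(y in A) (fp x y : nat) <= 2 * D.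
    apply: leq_trans hfull; rewrite pair_big /= -sum1_card big_mkcond [X in _ <= X]big_mkcond /=.
    apply: leq_sum => -[x y] _; rewrite [(x, y) \in [set _ | _]]inE /= -/(fp x y).
    by case: (_ && _); case: (fp x y).
  rewrite mul2n -addnn; apply: leq_trans (leq_add (leq_add E1 E2) E3).
  rewrite -!big_split /=; apply: leq_sum => x xA; rewrite -!big_split /=.
  by apply: leq_sum => y yA; apply: ptw.
have sumA : e2 g A S + \sum_(x in A) miss x = #|S| * #|A|.
  rewrite e2_sum -big_split /= mulnC -sum_nat_const; apply: eq_bigr => x _.
  by rewrite /miss subnKC.
rewrite -cR; clear -boundU boundA sumA; nia.
Qed.

End AroundCore.

(** * Graphs with an edge meeting all edges *)

Lemma inj_between (T V : finType) (v0 : V) (A : {set T}) (B : {set V}) : #|A| <= #|B| ->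
  exists f : T -> V, {in A &, injective f} /\ {in A, forall t, f t \in B}.
Proof.
move=> hAB; exists (fun t => nth v0 (enum B) (index t (enum A))).
have hi t : t \in A -> index t (enum A) < size (enum B).
  by move=> tA; rewrite -cardE (leq_trans _ hAB) // cardE index_mem mem_enum.
split=> [a b aA bA /eqP|t tA]; last by rewrite -mem_enum mem_nth // hi.
rewrite nth_uniq ?enum_uniq ?hi // => /eqP E.
by rewrite -(nth_index a (_ : a \in enum A)) ?mem_enum // E nth_index // mem_enum.
Qed.

Lemma bigmin_le (I : finType) (P : pred I) (F : I -> nat) x0 k :
  \big[minn/x0]_(i | P i) F i <= k -> x0 <= k \/ exists2 i, P i & F i <= k.
Proof.
apply: (big_ind (fun m => m <= k -> x0 <= k \/ exists2 i, P i & F i <= k)).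
- by left.
- by move=> a b IHa IHb; rewrite geq_min => /orP[/IHa|/IHb].
- by move=> i Pi Fi; right; exists i.
Qed.

Lemma bigmin_ge (I : finType) (P : pred I) (F : I -> nat) x0 i :
  P i -> \big[minn/x0]_(j | P j) F j <= F i.
Proof.
move=> Pi; have := mem_index_enum i; elim: (index_enum I) => //= j r IH.
rewrite in_cons big_cons => /predU1P[<-|/IH h]; first by rewrite Pi geq_minl.
by case: ifP => _ //; rewrite geq_min h orbT.
Qed.

Section Book.
Variables (T : finType) (F : sgraph T).
Local Notation e := (adj F).

Definition edge_cover u1 u2 :=
  e u1 u2 /\ forall x y, e x y -> [|| x == u1, x == u2, y == u1 | y == u2].

Lemma edge_cover_sym u1 u2 : edge_cover u1 u2 -> edge_cover u2 u1.
Proof.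
case=> h1 h2; split=> [|x y /h2]; first by rewrite (adj_sym F).
by case/or4P=> ->; rewrite ?orbT.
Qed.

Lemma adj_neq x y : e x y -> x != y.
Proof. by apply: contraTneq => ->; rewrite (adj_irr F). Qed.

Lemma edge_controlP u1 u2 : e u1 u2 -> reflect (edge_cover u1 u2) (edge_control F [set [set u1; u2]]).
Proof.
move=> u12; have mem_edges x y : e x y -> [set x; y] \in edges e.
  by move=> exy; rewrite inE; apply/existsP; exists x; apply/existsP; exists y; rewrite exy eqxx.
apply: (iffP andP) => [[_ /forall_inP h]|[_ h]].
  split=> // x y exy; have [E|ne] := eqVneq [set x; y] [set u1; u2].
    by have := set21 x y; rewrite E !inE => /orP[] ->; rewrite ?orbT.
  have : [set x; y] \in edges e :\ [set u1; u2] by rewrite in_setD1 ne mem_edges.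
  case/h/exists_inP=> _ /set1P ->.
  case/set0Pn=> z; rewrite !inE => /andP[/orP[] /eqP-> /orP[] ->]; rewrite ?orbT //.
split; first by rewrite sub1set mem_edges.
apply/forall_inP=> E; rewrite !inE => /andP[_ /existsP[x /existsP[y /andP[exy /eqP->]]]].
apply/exists_inP; exists [set u1; u2]; first exact: set11.
by apply/set0Pn; case/or4P: (h x y exy) => /eqP E'; [exists x|exists x|exists y|exists y];
  rewrite !inE E' eqxx ?orbT.
Qed.

Lemma beta1_edge_cover : beta1 F = 1 -> exists u1 u2, edge_cover u1 u2.
Proof.
rewrite /beta1; case: ex_minnP => k /existsP[E /andP[cE /eqP cardE]] _ k1.
have /eqP/cards1P[f Ef] : #|E| = 1 by rewrite cardE.
have : f \in edges e by case/andP: (cE) => /subsetP sE _; apply: sE; rewrite Ef set11.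
rewrite inE => /existsP[x /existsP[y /andP[exy /eqP fE]]].
by exists x, y; apply/(edge_controlP exy); rewrite -fE -Ef.
Qed.

(** Without a common neighbour of [u1] and [u2], colouring each vertex by its adjacency to [u1]
    would be a proper 2-colouring. *)
Lemma chi_triangle u1 u2 : edge_cover u1 u2 -> 3 <= chi F -> exists2 w, e u1 w & e u2 w.
Proof.
move=> [u12 hc]; rewrite /chi; case: ex_minnP => k _ hk k3.
have [/existsP[w /andP[]]|/existsPn h] := boolP [exists w, e u1 w && e u2 w]; first by exists w.
suff /hk : colorable F 2 by rewrite leqNgt k3.
apply/existsP; exists [ffun x => inord (e u1 x) : 'I_2].
apply/forallP=> x; apply/forallP=> y; apply/implyP=> exy; rewrite !ffunE.
rewrite -val_eqE /= !inordK; try by case: (e u1 _).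
wlog : x y exy / (x == u1) || (x == u2).
  move=> H; case/or4P: (hc x y exy) => h'; try by apply: H; rewrite // h' ?orbT.
    by rewrite eq_sym; apply: H; rewrite ?h' // (adj_sym F).
  by rewrite eq_sym; apply: H; rewrite ?h' ?orbT // (adj_sym F).
case/orP=> /eqP xE; rewrite xE in exy *; first by rewrite exy (adj_irr F).
by rewrite u12; have := h y; rewrite exy andbT => /negbTE->.
Qed.

Lemma dominated u1 u2 t : no_isolated F -> edge_cover u1 u2 -> t != u1 -> t != u2 ->
  e u1 t || e u2 t.
Proof.
move=> ni [_ hc] t1 t2; have [y ety] := ni t.
have := hc t y ety; rewrite (negbTE t1) (negbTE t2) /= => /orP[] /eqP Ey;
  by move: ety; rewrite Ey (adj_sym F) => ->; rewrite ?orbT.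
Qed.

Lemma embed_cover (V : finType) (g : rel V) (phi : T -> V) u1 u2 : symmetric g ->
  edge_cover u1 u2 -> injective phi ->
  (forall t, e u1 t -> g (phi u1) (phi t)) -> (forall t, e u2 t -> g (phi u2) (phi t)) ->
  contains g e.
Proof.
move=> gs [_ hc] ip h1 h2; apply/existsP; exists (finfun phi); apply/andP; split.
  by apply/injectiveP => a b; rewrite !ffunE => /ip.
apply/forallP=> x; apply/forallP=> y; apply/implyP=> exy; rewrite !ffunE.
have eyx : e y x by rewrite (adj_sym F).
case/or4P: (hc x y exy) => /eqP E; rewrite E in exy eyx *; rewrite ?h1 ?h2 //.
  by rewrite gs h1.
by rewrite gs h2.
Qed.

(** An edge with [#|T| - 2] common neighbours spans a book, which contains every graph on [T] whose
    edges all meet [u1] or [u2]. *)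
Lemma embed_book (V : finType) (g : rel V) u1 u2 x y (X : {set V}) :
  symmetric g -> irreflexive g -> edge_cover u1 u2 -> g x y ->
  (forall z, z \in X -> g x z && g y z) -> #|T| <= #|X| + 2 -> contains g e.
Proof.
move=> gs gi hc gxy hX cX; have [u12 _] := hc; have nu := adj_neq u12.
pose A := ~: [set u1; u2].
have [|f [fi fX]] := @inj_between T V x A X.
  by move: cX; rewrite -(cardsC [set u1; u2]) cards2 nu /= addnC leq_add2r.
have inA t : t != u1 -> t != u2 -> t \in A by move=> t1 t2; rewrite !inE (negbTE t1) (negbTE t2).
have fx t : t \in A -> f t != x by move=> /fX /hX /andP[+ _]; apply: contraTneq => ->; rewrite gi.
have fy t : t \in A -> f t != y by move=> /fX /hX /andP[_]; apply: contraTneq => ->; rewrite gi.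
have xy : y != x by apply: contraTneq gxy => ->; rewrite gi.
pose phi t := if t == u1 then x else if t == u2 then y else f t.
have phi1 : phi u1 = x by rewrite /phi eqxx.
have phi2 : phi u2 = y by rewrite /phi eq_sym (negbTE nu) eqxx.
have phiA t : t != u1 -> t != u2 -> phi t = f t by rewrite /phi => /negbTE-> /negbTE->.
have phix t : (phi t == x) = (t == u1).
  have [->|t1] := eqVneq t u1; first by rewrite phi1 eqxx.
  by apply/negbTE; have [->|t2] := eqVneq t u2; rewrite ?phi2 // phiA // fx // inA.
have phiy t : (phi t == y) = (t == u2).
  have [->|t2] := eqVneq t u2; first by rewrite phi2 eqxx.
  apply/negbTE; have [->|t1] := eqVneq t u1; first by rewrite phi1 eq_sym.
  by rewrite phiA // fy // inA.
apply: (@embed_cover V g phi u1 u2) => //.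
- move=> a b E; have := phix a; have := phiy a; rewrite E phix phiy.
  have [->|b1] := eqVneq b u1; first by move=> _ /esym/eqP.
  have [->|b2] := eqVneq b u2; first by move=> /esym/eqP.
  move=> /esym/negbT a2 /esym/negbT a1; move: E; rewrite !phiA //.
  by apply: fi; apply: inA.
- move=> t e1t; have t1 : t != u1 by rewrite eq_sym adj_neq.
  have [->|t2] := eqVneq t u2; first by rewrite phi1 phi2.
  by rewrite phi1 phiA //; have /hX/andP[] := fX t (inA t t1 t2).
- move=> t e2t; have t2 : t != u2 by rewrite eq_sym adj_neq.
  have [->|t1] := eqVneq t u1; first by rewrite phi1 phi2 gs.
  by rewrite phi2 phiA //; have /hX/andP[] := fX t (inA t t1 t2).
Qed.

(** Send [u1], [u2], [w] to [x], [z], [y] with [z] in [S]. The other neighbours of [u1] go to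
    [S :\ z], where the degree bound makes room, and all remaining vertices go to [C]; uniqueness of
    [w] keeps further neighbours of [u2] out of the first group. *)
Lemma embed_triangle (V : finType) (g : rel V) u1 u2 w x y (S C : {set V}) :
  symmetric g -> irreflexive g -> edge_cover u1 u2 -> e u1 w -> e u2 w ->
  (forall t, e u1 t -> e u2 t -> t = w) -> deg F u1 <= #|S|.+1 ->
  g x y -> x \notin S -> y \notin S -> (forall z, z \in S -> g z x && g z y) ->
  (forall z v, z \in S -> v \in C -> g z v) -> #|T| + 2 <= #|C| -> contains g e.
Proof.
move=> gs gi hc e1w e2w uw hdeg gxy xS yS full SC cC.
have [u12 _] := hc; have u21 : e u2 u1 by rewrite (adj_sym F).
have nu := adj_neq u12; have w1 := adj_neq e1w; have w2 := adj_neq e2w.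
have hdeg2 : deg F u1 = #|[set t | e u1 t] :\ u2 :\ w| + 2.
  rewrite /deg (cardsD1 u2 [set t | e u1 t]) inE u12 (cardsD1 w (_ :\ u2)) !inE e1w.
  by rewrite (eq_sym w) w2 /=; lia.
set A1 := _ :\ w in hdeg2.
have [z zS] : exists z, z \in S by apply/card_gt0P; lia.
pose A2 := ~: ([set u1; u2; w] :|: A1).
have [|f1 [i1 f1S]] := @inj_between T V x A1 (S :\ z).
  by have := cardsD1 z S; rewrite zS; clear -hdeg hdeg2; lia.
have [|f2 [i2 f2C]] := @inj_between T V x A2 (C :\ x :\ y).
  have hA2 : #|A2| <= #|T| := max_card _.
  have := cardsD1 x C; have := cardsD1 y (C :\ x); have := leq_b1 (x \in C).
  have := leq_b1 (y \in C :\ x); move: (x \in C : nat) (y \in C :\ x : nat) => i j.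
  by clear -cC hA2; lia.
have CS v : v \in C -> v \notin S by move=> vC; apply/negP=> vS; have := SC _ _ vS vC; rewrite gi.
have xy : y != x by apply: contraTneq gxy => ->; rewrite gi.
have zx : x != z by apply: contraNneq xS => ->.
have zy : y != z by apply: contraNneq yS => ->.
pose phi t := if t == u1 then x else if t == u2 then z else if t == w then y
  else if e u1 t then f1 t else f2 t.
(* The five branches of [phi] have disjoint ranges, told apart by [vtag], so injectivity needs
   checking only within a branch. *)
pose tag t := if t == u1 then 0 else if t == u2 then 1 else if t == w then 2
  else if e u1 t then 3 else 4.
pose vtag v := if v == x then 0 else if v == z then 1 else if v == y then 2
  else if v \in S then 3 else 4.
have A1P t : t != u2 -> t != w -> e u1 t -> t \in A1 by move=> h1 h2 h3; rewrite !inE h1 h2 h3.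
have A2P t : t != u1 -> t != u2 -> t != w -> ~~ e u1 t -> t \in A2.
  by move=> h0 h1 h2 h3; rewrite !inE (negbTE h0) (negbTE h1) (negbTE h2) (negbTE h3) !andbF.
have tagP t : vtag (phi t) = tag t.
  rewrite /tag /phi; case: eqP => [_|/eqP t1]; first by rewrite /vtag eqxx.
  case: eqP => [_|/eqP t2]; first by rewrite /vtag eq_sym (negbTE zx) eqxx.
  case: eqP => [_|/eqP t3]; first by rewrite /vtag (negbTE xy) (negbTE zy) eqxx.
  case: ifP => [t4|/negbT t4].
    have := f1S t (A1P t t2 t3 t4); rewrite !inE => /andP[fz fS]; rewrite /vtag fS (negbTE fz).
    have -> : (f1 t == x) = false by apply: contraTF fS => /eqP->.
    by have -> : (f1 t == y) = false by apply: contraTF fS => /eqP->.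
  have := f2C t (A2P t t1 t2 t3 t4); rewrite !inE => /and3P[fy fx /CS fS].
  rewrite /vtag (negbTE fx) (negbTE fy) (negbTE fS).
  by have -> : (f2 t == z) = false by apply: contraNF fS => /eqP->.
have inj : injective phi.
  move=> a b E; have := tagP a; rewrite E tagP; move: E; rewrite /tag /phi.
  case: (eqVneq a u1) => [a1|a1]; case: (eqVneq b u1) => [b1|b1]; try (by rewrite a1 b1);
  case: (eqVneq a u2) => [a2|a2]; case: (eqVneq b u2) => [b2|b2]; try (by rewrite a2 b2); try done;
  case: (eqVneq a w) => [a3|a3]; case: (eqVneq b w) => [b3|b3]; try (by rewrite a3 b3); try done;
  case: ifP => [a4|/negbT a4]; try done; case: ifP => [b4|/negbT b4]; try done.
    by move=> E _; apply: i1 E; apply: A1P.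
  by move=> E _; apply: i2 E; apply: A2P.
have phi1 : phi u1 = x by rewrite /phi eqxx.
have phi2 : phi u2 = z by rewrite /phi eq_sym (negbTE nu) eqxx.
have phiw : phi w = y by rewrite /phi !(eq_sym w) (negbTE w1) (negbTE w2) eqxx.
have /andP[gzx gzy] := full z zS.
apply: (@embed_cover V g phi u1 u2) => //.
- move=> t e1t; rewrite phi1; have [->|t2] := eqVneq t u2; first by rewrite phi2 gs.
  have [->|t3] := eqVneq t w; first by rewrite phiw.
  have -> : phi t = f1 t.
    by rewrite /phi e1t (negbTE t2) (negbTE t3) eq_sym (negbTE (adj_neq e1t)).
  by have := f1S t (A1P t t2 t3 e1t); rewrite !inE gs => /andP[_ /full/andP[]].
- move=> t e2t; rewrite phi2; have [->|t1] := eqVneq t u1; first by rewrite phi1.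
  have [->|t3] := eqVneq t w; first by rewrite phiw.
  have t4 : ~~ e u1 t by apply/negP => e1t; move/eqP: t3; apply; apply: uw.
  have t2 : t != u2 by rewrite eq_sym adj_neq.
  rewrite /phi (negbTE t1) (negbTE t2) (negbTE t3) (negbTE t4).
  by have := f2C t (A2P t t1 t2 t3 t4); rewrite !inE => /and3P[_ _ ?]; apply: SC.
Qed.

(** * Triangles of [F] and the parameter [f(F)] *)

Definition is_triangle (Q : {set T}) :=
  (#|Q| == 3) && [forall x in Q, forall y in Q, (x != y) ==> e x y].

Lemma is_triangle3 u1 u2 w : e u1 u2 -> e u1 w -> e u2 w -> is_triangle [set u1; u2; w].
Proof.
move=> h1 h2 h3; rewrite /is_triangle; apply/andP; split.
  by rewrite setUC cardsU1 cards2 !inE negb_or !(eq_sym w) !adj_neq.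
apply/forall_inP=> x; rewrite !inE => hx; apply/forall_inP=> y; rewrite !inE => hy.
by move: hx hy => /orP[/orP[]|] /eqP-> /orP[/orP[]|] /eqP->; rewrite ?eqxx ?h1 ?h2 ?h3 ?implybT //;
  rewrite (adj_sym F) ?h1 ?h2 ?h3 ?implybT.
Qed.

(** If [u1] were not in [Q], two vertices of [Q] other than [u2] would span an uncovered edge.
    Triangles thus correspond to common neighbours of [u1] and [u2]. *)
Lemma triangle_cover u1 u2 Q : edge_cover u1 u2 -> is_triangle Q ->
  exists2 w, e u1 w && e u2 w & Q = [set u1; u2; w].
Proof.
move=> hc /andP[/eqP cQ /forall_inP hQ].
have memQ v1 v2 : edge_cover v1 v2 -> v1 \in Q.
  move=> [_ hv]; apply/negPn/negP=> v1Q.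
  have : 1 < #|Q :\ v2| by have := cardsD1 v2 Q; rewrite cQ; case: (_ \in Q); lia.
  case/card_gt1P=> a [b [+ + ab]]; rewrite !inE => /andP[a2 aQ] /andP[b2 bQ].
  have /forall_inP/(_ b bQ)/implyP/(_ ab) /hv := hQ a aQ.
  rewrite (negbTE a2) (negbTE b2) => /or4P[] // /eqP E; move: v1Q; rewrite -E ?aQ ?bQ //.
have Q1 := memQ _ _ hc; have Q2 := memQ _ _ (edge_cover_sym hc).
have [u12 _] := hc; have nu := adj_neq u12.
have : #|Q :\ u1 :\ u2| = 1.
  have := cardsD1 u1 Q; have := cardsD1 u2 (Q :\ u1); rewrite !inE Q1 Q2 eq_sym nu cQ /=; lia.
move/eqP/cards1P=> [w Ew]; have : w \in Q :\ u1 :\ u2 by rewrite Ew set11.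
rewrite !inE => /and3P[w2 w1 wQ].
have adjQ a b : a \in Q -> b \in Q -> a != b -> e a b.
  by move=> aQ bQ ab; have /forall_inP/(_ b bQ)/implyP/(_ ab) := hQ a aQ.
exists w; first by rewrite !adjQ // eq_sym.
by rewrite -setUA -Ew setD1K ?inE ?(eq_sym u2) ?nu ?Q2 // setD1K.
Qed.

Lemma ntri_unique u1 u2 w t : ntri F = 1 -> e u1 u2 -> e u1 w -> e u2 w -> e u1 t -> e u2 t -> t = w.
Proof.
rewrite /ntri => /eqP/cards1P[Q EQ] h12 h1w h2w h1t h2t.
have mQ v : e u1 v -> e u2 v -> [set u1; u2; v] = Q.
  move=> h1 h2; apply/set1P; rewrite -EQ inE; exact: is_triangle3.
have : t \in [set u1; u2; w] by rewrite mQ // -(mQ t) // !inE eqxx !orbT.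
rewrite !inE -orbA => /or3P[/eqP E|/eqP E|/eqP//].
  by move: h1t; rewrite E (adj_irr F).
by move: h2t; rewrite E (adj_irr F).
Qed.

Lemma ntri1 u1 u2 w : edge_cover u1 u2 -> e u1 w -> e u2 w ->
  (forall t, e u1 t -> e u2 t -> t = w) -> ntri F = 1.
Proof.
move=> hc h1 h2 hu; apply/eqP/cards1P; exists [set u1; u2; w].
apply/setP=> Q; rewrite !inE; apply/idP/eqP => [/(triangle_cover hc)[t /andP[h1t h2t] ->]|->].
  by rewrite (hu t).
by apply: is_triangle3 => //; case: hc.
Qed.

(** The hypothesis rules out the default value [#|T|] of the minimum, so the minimum is attained at
    an actual covering edge. *)
Lemma fF_cover : fF F < #|T| -> exists u1 u2, edge_cover u1 u2 /\ deg F u1 <= fF F.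
Proof.
move=> hT; have [h|[[u1 u2] /andP[/= u12 /(edge_controlP u12) hc]]] := bigmin_le (leqnn (fF F)).
  by move: hT; rewrite ltnNge h.
rewrite geq_min => /orP[h|h]; first by exists u1, u2.
by exists u2, u1; split=> //; apply: edge_cover_sym.
Qed.

Lemma fF_le u1 u2 : edge_cover u1 u2 -> fF F <= deg F u1.
Proof.
move=> hc; have [u12 _] := hc.
apply: leq_trans (geq_minl (deg F u1) (deg F u2)).
apply: (bigmin_ge _ _ (i := (u1, u2))); rewrite /= u12; exact/edge_controlP.
Qed.

End Book.

(** * The extremal graphs *)

Lemma card_edges (V : finType) (g : rel V) : symmetric g -> irreflexive g ->
  2 * nedges g = e2 g setT setT.
Proof.
move=> gs gi; pose P := [set p : V * V | g p.1 p.2].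
have -> : e2 g setT setT = #|P|.
  rewrite /e2 pair_big /= -sum1_card [RHS]big_mkcond /=; apply: eq_big => [[x y]|[x y] _].
    by rewrite !inE.
  by rewrite inE /=; case: (g x y).
have hP p : p \in P -> [set p.1; p.2] \in edges g.
  by rewrite !inE => gp; apply/existsP; exists p.1; apply/existsP; exists p.2; rewrite gp eqxx.
rewrite -[#|P|]sum1_card (partition_big (fun p => [set p.1; p.2]) (mem (edges g))) //=.
rewrite mulnC /nedges -sum_nat_const; apply: eq_bigr => E; rewrite inE => /existsP[x /existsP[y /andP[gxy /eqP->]]].
have xy : x != y by apply: contraTneq gxy => ->; rewrite gi.
have <- : #|[set (x, y); (y, x)]| = 2.
  by rewrite cards2 xpair_eqE negb_and xy.
rewrite -sum1_card; apply: eq_bigl => -[a b]; rewrite !inE /= !xpair_eqE.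
apply/orP/andP => [[/andP[/eqP-> /eqP->]|/andP[/eqP-> /eqP->]]|[gab /eqP/setP E']].
- by rewrite gxy eqxx.
- by rewrite gs gxy setUC eqxx.
have := E' a; have := E' b; have := E' x; rewrite !inE !eqxx !orbT /= => hx hb ha.
have ab : a != b by apply: contraTneq gab => ->; rewrite gi.
move: ha hb hx ab; rewrite ![x == _]eq_sym.
have [->|ax] := eqVneq a x; have [->|bx] := eqVneq b x => //=; rewrite ?eqxx ?andbT ?orbT //=.
- by move=> _ <-; left.
- by move=> <- _; right.
Qed.

Section Biclique.
Variables (V : finType) (S : {set V}) (o1 o2 : V) (D : bool).
Hypotheses (o1S : o1 \notin S) (o2S : o2 \notin S) (o12 : o1 != o2).

Definition special x y := ((x == o1) && (y == o2)) || ((x == o2) && (y == o1)).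

Definition biclique : rel V := fun x y => ((x \in S) != (y \in S)) || D && special x y.

Lemma special_sym x y : special x y = special y x.
Proof. by rewrite /special orbC andbC [X in _ || X]andbC. Qed.

Lemma biclique_sym : symmetric biclique.
Proof. by move=> x y; rewrite /biclique eq_sym special_sym. Qed.

Lemma biclique_irr : irreflexive biclique.
Proof.
move=> x; rewrite /biclique eqxx /special; apply/negP=> /andP[_].
by case/orP=> /andP[/eqP-> /eqP E]; move: o12; rewrite E eqxx.
Qed.

Lemma special_notin x y : special x y -> (x \notin S) && (y \notin S).
Proof. by case/orP=> /andP[/eqP-> /eqP->]; rewrite o1S o2S. Qed.

Lemma special_inj x y z : special x y -> special x z -> y = z.
Proof.
by rewrite /special => /orP[] /andP[/eqP-> /eqP->] /orP[] /andP[/eqP E /eqP->].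
Qed.

Lemma special_mem x y z t : special x y -> special z t -> (z == x) || (z == y).
Proof. by case/orP=> /andP[/eqP-> /eqP->] /orP[] /andP[/eqP-> _]; rewrite eqxx ?orbT. Qed.

Lemma biclique_e2 : e2 biclique setT setT = 2 * (#|S| * #|~: S| + D).
Proof.
have E := e2_split biclique_sym (subsetT S); rewrite E setTD.
have -> : e2 biclique S S = 0.
  apply: big1 => x xS; apply: big1 => y yS; apply/eqP; rewrite eqb0 /biclique xS yS /=.
  by apply/negP=> /andP[_ /special_notin]; rewrite xS.
have -> : e2 biclique S (~: S) = #|S| * #|~: S|.
  rewrite -sum_nat_const; apply: eq_bigr => x xS; rewrite -sum1_card; apply: eq_bigr => y.
  by rewrite inE /biclique xS => /negbTE->.
suff -> : e2 biclique (~: S) (~: S) = 2 * D by clear; lia.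
have o1s : [set o1] \subset ~: S by rewrite sub1set inE.
rewrite (e2_split biclique_sym o1s) e211; last exact: biclique_irr.
have bout x y : x \in ~: S -> y \in ~: S -> biclique x y = D && special x y.
  by rewrite !inE /biclique => /negbTE-> /negbTE->.
have -> : e2 biclique (~: S :\ o1) (~: S :\ o1) = 0.
  apply: big1 => x /setD1P[x1 xS]; apply: big1 => y /setD1P[y1 yS]; apply/eqP.
  by rewrite eqb0 bout // /special (negbTE x1) (negbTE y1) /= andbF andbF.
rewrite addn0 add0n; congr (2 * _).
rewrite e21; have -> : [set y in ~: S :\ o1 | biclique o1 y] = if D then [set o2] else set0.
  apply/setP=> y; rewrite inE; have [yS|] := boolP (y \in ~: S :\ o1); last first.
    case: D => /=; rewrite !inE // negb_and negbK => /orP[/eqP->|].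
      by rewrite (negbTE o12).
    by rewrite negbK => yS; apply/esym/negbTE; apply: contraNneq o2S => <-.
  move: (yS) => /setD1P[y1 yS']; rewrite bout // ?(subsetP o1s) ?set11 // /special eqxx (negbTE y1) andbF orbF.
  by case: D; rewrite ?inE.
by case: D; rewrite ?cards1 ?cards0.
Qed.

(** Without the added edge the graph is bipartite, so every triangle uses that edge. *)
Lemma biclique_triangle x y z : biclique x y -> biclique y z -> biclique x z ->
  D /\ [|| special x y, special y z | special x z].
Proof.
rewrite /biclique; case: D => /=.
  by case: (x \in S); case: (y \in S); case: (z \in S) => //=; rewrite ?orbF => *; split=> //;
     apply/or3P; try (by apply: Or31); try (by apply: Or32); apply: Or33.
by rewrite !orbF; case: (x \in S); case: (y \in S); case: (z \in S).
Qed.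

Lemma biclique_nbr x y t : D -> special x y -> biclique x t -> (t == y) || (t \in S).
Proof.
move=> hD sxy; have /andP[/negbTE xS _] := special_notin sxy; rewrite /biclique xS.
by case: (t \in S); rewrite ?orbT //= => /andP[_ /(special_inj sxy) ->]; rewrite eqxx.
Qed.

(** A triangle [u1 u2 w] of [F] is mapped onto one through the added edge. If that edge is the image
    of [u1 u2], every other vertex, being adjacent to [u1] or [u2], goes to [S], so [F] is too
    small. If it is the image of an edge at [w], the triangle is unique and one of [u1], [u2] has
    too small a degree. *)
Lemma biclique_book_free (T : finType) (F : sgraph T) : no_isolated F -> 3 <= chi F -> beta1 F = 1 ->
  (D -> (#|S|.+2 < #|T|) && ~~ ((ntri F == 1) && (fF F <= #|S|.+1))) ->
  ~~ contains biclique (adj F).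
Proof.
move=> ni c3 b1 hD; apply/negP=> /existsP[phi /andP[/injectiveP ip /forallP hphi]].
have hom a b : adj F a b -> biclique (phi a) (phi b).
  by move=> ab; have /forallP/(_ b)/implyP := hphi a; apply.
have main u1 u2 w : edge_cover F u1 u2 -> adj F u1 w -> adj F u2 w -> D ->
    special (phi u1) (phi w) -> False.
  move=> hc h1 h2 D1 sp; have [h12 _] := hc.
  have uni t : adj F u1 t -> adj F u2 t -> t = w.
    move=> h1t h2t; have [_ /or3P[]] := biclique_triangle (hom _ _ h12) (hom _ _ h2t) (hom _ _ h1t).
    + move/(special_inj sp)/ip => E; by move: h2; rewrite E (adj_irr F).
    + move/(special_mem sp); rewrite !(inj_eq ip) (eq_sym u2) (negbTE (adj_neq h12)).
      by rewrite (negbTE (adj_neq h2)).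
    + by move/(special_inj sp)/ip.
  case/andP: (hD D1) => _ /negP[]; rewrite (ntri1 hc h1 h2 uni) eqxx /=.
  apply: leq_trans (fF_le hc) _; rewrite /deg -(card_imset _ ip).
  apply: (@leq_trans #|phi w |: S|); last by rewrite cardsU1; case: (_ \notin S).
  apply: subset_leq_card; apply/subsetP=> v /imsetP[t]; rewrite inE => /hom h ->.
  by rewrite !inE; apply: biclique_nbr sp h.
have [u1 [u2 hc]] := beta1_edge_cover b1; have [h12 _] := hc.
have [w h1 h2] := chi_triangle hc c3.
have [D1 /or3P[sp|sp|sp]] := biclique_triangle (hom _ _ h12) (hom _ _ h2) (hom _ _ h1).
- case/andP: (hD D1) => + _; rewrite ltnNge => /negP[].
  rewrite -(cardsC [set u1; u2]) cards2 (adj_neq h12) add2n !ltnS -(card_imset _ ip).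
  apply: subset_leq_card; apply/subsetP=> v /imsetP[t + ->]; rewrite !inE negb_or => /andP[t1 t2].
  case/orP: (dominated ni hc t1 t2) => /hom.
    by move/(biclique_nbr D1 sp); rewrite (inj_eq ip) (negbTE t2).
  rewrite special_sym in sp.
  by move/(biclique_nbr D1 sp); rewrite (inj_eq ip) (negbTE t1).
- exact: (main u2 u1 w (edge_cover_sym hc)).
- exact: (main u1 u2 w hc).
Qed.

(** Replaces the dependent pairs of [LFV s] by two natural indices; [x0] is the value out of
    range. *)
Lemma contains_paths (g : rel V) (x0 : V) s : contains g (lf_adj s) -> exists psi : nat -> nat -> V,
  (forall i a j b, i < size (lf_sizes s) -> j < size (lf_sizes s) ->
    a < nth 0 (lf_sizes s) i -> b < nth 0 (lf_sizes s) j -> psi i a = psi j b -> i = j /\ a = b) /\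
  (forall i a, i < size (lf_sizes s) -> a.+1 < nth 0 (lf_sizes s) i -> g (psi i a) (psi i a.+1)).
Proof.
case/existsP=> phi /andP[/injectiveP ip /forallP hphi].
pose psi i a := if insub i is Some i' then
  if insub a is Some a' then phi (existT (fun i : 'I_(size (lf_sizes s)) => 'I_(nth 0 (lf_sizes s) i)) i' a')
  else x0 else x0.
have psiE i a (hi : i < size (lf_sizes s)) (ha : a < nth 0 (lf_sizes s) i) :
    psi i a = phi (existT _ (Ordinal hi) (Ordinal (ha : a < nth 0 (lf_sizes s) (Ordinal hi)))).
  by rewrite /psi insubT /= insubT.
exists psi; split=> [i a j b hi hj ha hb|i a hi ha].
  rewrite !psiE => /ip E; have ij : i = j by have := congr1 (fun x => val (tag x)) E.
  by split=> //; have := congr1 (fun x : LFV s => (val (tagged x) : nat)) E.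
rewrite (psiE _ _ hi (ltnW ha)) (psiE _ _ hi ha);
  have /forallP := hphi (existT _ (Ordinal hi) (Ordinal (ltnW ha : a < nth 0 (lf_sizes s) (Ordinal hi)))).
move/(_ (existT _ (Ordinal hi) (Ordinal (ha : a.+1 < nth 0 (lf_sizes s) (Ordinal hi))))).
by rewrite /lf_adj /= !eqxx.
Qed.

(** Pair up consecutive vertices along each component, [c.2] pairs in each. A pair other than the
    added edge has an end in [S], which gives [ell s] distinct vertices of [S]. *)
Lemma biclique_linear_free s : #|S| < ell s -> (D -> all (fun c => ~~ c.1) s) ->
  ~~ contains biclique (lf_adj s).
Proof.
move=> cS hD; apply/negP=> /(contains_paths o1)[psi [ip hom]].
set k := size (lf_sizes s) in ip hom; pose l i := (nth (false, 0) s i).2.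
have ks : k = size s by rewrite /k size_map.
have szE i : i < k -> nth 0 (lf_sizes s) i = comp_size (nth (false, 0) s i).
  by move=> ik; rewrite (nth_map (false, 0)) // -ks.
have sz0 i : i < k -> 2 * l i <= nth 0 (lf_sizes s) i.
  by move=> ik; rewrite szE // /comp_size /l; case: (_.1).
have sz1 i : D -> i < k -> 2 * l i < nth 0 (lf_sizes s) i.
  move=> /hD/allP h ik; rewrite szE // /comp_size /l.
  by have := h _ (mem_nth (false, 0) (_ : i < size s)); rewrite -ks => /(_ ik)/negbTE->.
(* The offset [o] selects the pairs. When [D] holds all components are odd, so both offsets fit, and
   the added edge spoils at most one of them. *)
have [o [o1' ho]] : exists o, (o = 0 \/ D /\ o = 1) /\ forall i a, i < k -> a < l i ->
    ~~ (D && special (psi i (2 * a + o)) (psi i (2 * a + o).+1)).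
  have [D0|D0] := boolP D; last by exists 0; split; [left | ].
  have [/existsP[i /existsP[a sa]]|/existsPn h] :=
      boolP [exists i : 'I_k, exists a : 'I_(l i), special (psi i (2 * a)) (psi i (2 * a).+1)].
    exists 1; split; first by right.
    move=> j b jk bl; apply/negP=> sb; have ai := ltn_ord a; have ik := ltn_ord i.
    have := sz1 i D0 ik; have := sz1 j D0 jk => szj szi.
    (* If both matchings used the added edge, their positions would agree in one of the two
       orientations; both are arithmetically impossible. *)
    have : psi i (2 * a) = psi j (2 * b + 1) \/ psi i (2 * a) = psi j (2 * b + 1).+1 /\
           psi i (2 * a).+1 = psi j (2 * b + 1).
      by move: sa sb; rewrite /special => /orP[] /andP[/eqP-> /eqP->] /orP[] /andP[/eqP-> /eqP->];
        [left | right | right | left].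
    case=> [E|[E1 E2]].
      have [||_] := ip _ _ _ _ ik jk _ _ E; clear -ai bl szi szj; lia.
    have [||_ e1] := ip _ _ _ _ ik jk _ _ E1; [clear -ai szi; lia | clear -bl szj; lia | ].
    have [||_ e2'] := ip _ _ _ _ ik jk _ _ E2; [clear -ai szi; lia | clear -bl szj; lia | ].
    by clear -e1 e2'; lia.
  exists 0; split; first by left.
  move=> i a ik al; have /existsPn := h (Ordinal ik) => /(_ (Ordinal (al : a < l (Ordinal ik)))) /=.
  by rewrite addn0.
pose h i a := if psi i (2 * a + o) \in S then psi i (2 * a + o) else psi i (2 * a + o).+1.
have inb i a : i < k -> a < l i -> (2 * a + o).+1 < nth 0 (lf_sizes s) i.
  move=> ik al; case: o1' => [->|[D1 ->]]; first by have := sz0 i ik; clear -al; lia.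
  by have := sz1 i D1 ik; clear -al; lia.
have hS i a : i < k -> a < l i -> h i a \in S.
  move=> ik al; rewrite /h; case: ifPn => // nS.
  have := hom i (2 * a + o) ik (inb i a ik al).
  rewrite /biclique (negbTE nS) (negbTE (ho i a ik al)) orbF.
  by case: (_ \in S).
have hinj i a j b : i < k -> a < l i -> j < k -> b < l j -> h i a = h j b -> i = j /\ a = b.
  move=> ik al jk bl; rewrite /h; have ia := inb i a ik al; have jb := inb j b jk bl.
  have ia' := ltnW ia; have jb' := ltnW jb.
  have H a' b' : psi i a' = psi j b' -> a' < nth 0 (lf_sizes s) i -> b' < nth 0 (lf_sizes s) j ->
      i = j /\ a' = b' by move=> E pa pb; apply: ip E.
  by case: ifP => _; case: ifP => _ E; have [//|//|-> ab] := H _ _ E; split=> //; clear -ab; lia.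
pose L := [seq h i a | i <- iota 0 k, a <- iota 0 (l i)].
have uL : uniq L.
  apply: allpairs_uniq_dep; rewrite ?iota_uniq //; first by move=> i _; exact: iota_uniq.
  move=> [i a] [j b] /allpairsPdep[i' [a' [+ + ->]]] /allpairsPdep[j' [b' [+ + ->]]] /=.
  rewrite !mem_iota !add0n /= => ik al jk bl /(hinj _ _ _ _ ik al jk bl)[-> ->] //.
have sL : size L = ell s.
  rewrite size_allpairs_dep; congr sumn.
  apply: (@eq_from_nth _ 0); rewrite ?size_map ?size_iota // => i ik.
  by rewrite (nth_map 0) ?size_iota // nth_iota // add0n (nth_map (false, 0)) // -ks.
move: cS; rewrite ltnNge -sL => /negP[]; rewrite cardE; apply: uniq_leq_size => // y.
case/allpairsPdep=> i [a []]; rewrite !mem_iota !add0n /= => ik al ->.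
by rewrite mem_enum hS.
Qed.

End Biclique.

(** * The Turan number *)

Lemma eq_contains (A B : finType) (g g' : rel A) (h : rel B) : g =2 g' ->
  contains g h = contains g' h.
Proof.
move=> gg; apply: eq_existsb => phi; congr (_ && _).
by apply: eq_forallb => x; apply: eq_forallb => y; rewrite gg.
Qed.

Lemma propR_contains (V T : finType) (F : sgraph T) (g : rel V) (S C : {set V}) x y s :
  symmetric g -> irreflexive g -> 3 <= chi F -> beta1 F = 1 -> 0 < ell s ->
  #|S| = ell s - 1 -> (forall z v, z \in S -> v \in C -> g z v) -> #|T| + 2 <= #|C| ->
  x \notin S -> y \notin S -> g x y -> (forall z, z \in S -> g z x && g z y) ->
  ~~ has (fun c => c.1) s -> propR F s -> contains g (adj F).
Proof.
move=> gs gi c3 b1 l0 cS SC cC xS yS gxy full /negbTE ev; rewrite /propR ev /=.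
have small : #|T| <= (ell s).+1 -> contains g (adj F).
  move=> hT; have [u1 [u2 hc]] := beta1_edge_cover b1.
  apply: (@embed_book _ F V g u1 u2 x y S) => //; last by rewrite cS; clear -hT l0; lia.
  by move=> z /full; rewrite !(gs z).
case/orP=> [/small//|/andP[/eqP nt fF1]].
(* A larger [T] guarantees that [fF F] is not the default value of the minimum. *)
have [/small//|hT] := leqP #|T| (ell s).+1.
have [|u1 [u2 [hc hd]]] := @fF_cover _ F; first exact: leq_ltn_trans fF1 (ltnW hT).
have [w h1 h2] := chi_triangle hc c3; have [h12 _] := hc.
apply: (@embed_triangle _ F V g u1 u2 w x y S C) => //.
- by move=> t h1t h2t; apply: (ntri_unique nt h12 h1 h2).
- by apply: leq_trans hd _; rewrite cS; clear -fF1 l0; lia.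
Qed.

Lemma free_edge_bound (V T : finType) (F : sgraph T) (g : rel V) s :
  symmetric g -> irreflexive g -> 3 <= chi F -> beta1 F = 1 ->
  2 <= size s -> (forall c : bool * nat, c \in s -> if c.1 then 2 <= c.2 else 1 <= c.2) ->
  ~ all (pred1 (false, 1)) s ->
  size_bound (slack s + sumn (lf_sizes s) + 3 + #|T|) s <= #|V| ->
  ~~ contains g (lf_adj s) -> ~~ contains g (adj F) ->
  e2 g setT setT <= 2 * (ell s - 1) * (#|V| - (ell s - 1)) + 2 * D_FH F s.
Proof.
move=> gs gi c3 b1 ss hs hk hV nH nF.
have sp (c : bool * nat) : c \in s -> 0 < c.2 by move/hs; case: c.1 => //; apply: ltnW.
(* The component [c] is even whenever an even one exists; otherwise [H] differs from [kP_3], so some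
   odd component has [1 < c.2]. *)
have [c cs [c2 cev]] : exists2 c : bool * nat, c \in s & 1 < c.2 /\ (has (fun c => c.1) s -> c.1).
  have [/hasP[c cs c1]|/hasPn nev] := boolP (has (fun c => c.1) s).
    by exists c => //; have := hs c cs; rewrite c1.
  have /allPn[c cs c1] : ~~ all (pred1 (false, 1)) s by apply/negP.
  exists c => //; split=> //; have := sp c cs; have := nev c cs; move: c1.
  by case: (c) => -[] [|[|k]].
have [h|hE] := ltnP (e2 g setT setT) (2 * (ell s - 1) * (#|V| - (ell s - 1))).
  by apply: leq_trans (ltnW h) (leq_addr _ _).
have V0 : 0 < #|V| by apply: leq_trans hV.
have [x0 _] : exists x0, x0 \in V by apply/card_gt0P.
have nL : ~ linear_in g (lf_sizes s) by move=> /(linear_contains gs x0); apply/negP.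
have [|S [C [cS cC SC]]] := dense_structure gs gi ss sp _ hV hE nL; first by exists c.
have [_ cl _] := component_split cs.
have S0 : 0 < #|S| by rewrite cS; clear -cl c2; lia.
have cC' : slack s + sumn (lf_sizes s) + 3 <= #|C| by apply: leq_trans (leq_addr _ _) cC.
have [u1 [u2 hc]] := beta1_edge_cover b1.
(* An edge inside [S] together with its common neighbours in [C] is a book large enough to contain
   [F]. *)
have indep : e2 g S S = 0.
  apply: big1 => x xS; apply: big1 => y yS; apply/eqP; rewrite eqb0; apply: contra nF => gxy.
  apply: (@embed_book _ F V g u1 u2 x y C) => //; last by clear -cC; lia.
  by move=> z zC; rewrite !SC.
rewrite -cS; apply: edge_bound => //.
- move=> v y x z zS gzv nS gvy gyx.
  have := @attached_path V g gs gi s S C sp cS SC cC' nL v y x c z cs c2 zS gzv nS gvy.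
  by case: c.1 => // h; apply: h.
- by move=> U US; rewrite cS; apply: (@sparse_outside V g gs gi s S C).
set P := [set p | _].
have PP p : p \in P -> [/\ p.1 \notin S, p.2 \notin S, g p.1 p.2 &
    forall z, z \in S -> g z p.1 && g z p.2].
  by rewrite inE => /and4P[? ? ? /forall_inP].
have [->|/set0Pn[[x y] xyP]] := eqVneq P set0; first by rewrite cards0.
have [/= xS yS gxy fxy] := PP _ xyP.
have [z zS] : exists z, z \in S by apply/card_gt0P.
have /andP[gzx gzy] := fxy z zS.
have gyx : g y x by rewrite gs.
have gba a b : g a b -> g b a by rewrite gs.
(* An edge joined to all of [S] is incompatible with an even component, so by the choice of [c]
   there is none. *)
have odd : c.1 = false.
  apply/negbTE/negP => c1.
  have := @attached_path V g gs gi s S C sp cS SC cC' nL x y y c z cs c2 zS gzx.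
  by rewrite c1; apply.
have P3 u v t : u \notin S -> v \notin S -> t \notin S -> g z u -> g u v -> g v t -> t = u.
  move=> uS vS tS gzu guv.
  have := @attached_path V g gs gi s S C sp cS SC cC' nL u v t c z cs c2 zS gzu.
  by rewrite odd; apply.
rewrite /D_FH; case: ifPn => [pR|_].
  case/negP: nF; apply: (@propR_contains V T F g S C x y s) => //.
  - by clear -cl c2; lia.
  - by clear -cC; lia.
  - by apply: contraFN odd => /cev.
(* Outside property R one such edge may remain. A second one sharing an end with [x y] must coincide
   with it, and a disjoint one is excluded by [two_edges]. *)
have : #|[set (x, y); (y, x)]| <= 2 by rewrite cards2; case: eqP.
apply: leq_trans; apply: subset_leq_card; apply/subsetP=> -[a b] /PP[/= aS bS gab fab].
rewrite !inE !xpair_eqE; have /andP[gza gzb] := fab z zS.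
have [ax|ax] := eqVneq a x.
  have -> : b = y by apply: (P3 y x b); rewrite // -ax.
  by rewrite eqxx.
have [ay|ay] := eqVneq a y.
  have -> : b = x by apply: (P3 x y b); rewrite // -ay.
  by rewrite eqxx orbT.
exfalso; apply: (@two_edges V g gs gi s S C sp cS SC cC' nL x y a b c) => //.
- by move=> t /fxy/andP[].
- by move=> t /fab/andP[].
- have nxy : x != y by apply: contraTneq gxy => ->; rewrite gi.
  have nab : a != b by apply: contraTneq gab => ->; rewrite gi.
  have bx : b != x.
    by apply: contraNneq ay => E; apply/eqP; apply: (P3 y x a); rewrite // -E; apply: gba.
  have by' : b != y.
    by apply: contraNneq ax => E; apply/eqP; apply: (P3 x y a); rewrite // -E; apply: gba.
  by rewrite /= !inE !negb_or nxy nab ![x == _]eq_sym ![y == _]eq_sym ax bx ay by'.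
- by move=> t; rewrite !inE => /or4P[] /eqP->.
Qed.

Theorem theorem1p12 (s : seq (bool * nat)) (T : finType) (F : sgraph T) :
  2 <= size s ->
  (forall c, c \in s -> if c.1 then 2 <= c.2 else 1 <= c.2) ->
  ~ all (pred1 (false, 1)) s ->
  no_isolated F ->
  3 <= chi F ->
  beta1 F = 1 ->
  exists N, forall n, N <= n ->
    ex2 n (lf_adj s) (adj F) = (ell s - 1) * (n - ell s + 1) + D_FH F s.
Proof.
move=> ss hs hk ni c3 b1.
(* The argument of [size_bound] makes [C] large enough for embedding both [H] and [F]; the summand
   [ell s + 2] leaves room for the two ends of the added edge. *)
exists (size_bound (slack s + sumn (lf_sizes s) + 3 + #|T|) s + ell s + 2) => n hn.
have ell0 : 0 < ell s.
  by case: (s) ss hs => //= c s' _ /(_ c (mem_head _ _)); rewrite /ell /=; case: c.1; lia.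
have En : n - ell s + 1 = n - (ell s - 1) by clear -hn ell0; lia.
rewrite En; apply/eqP; rewrite eqn_leq; apply/andP; split.
  apply/bigmax_leqP=> g /and3P[/andP[/forallP gi /forallP gs] nH nF].
  have gs' : symmetric (ffrel g) by move=> x y; have /forallP/(_ y)/eqP := gs x.
  have gi' : irreflexive (ffrel g) by move=> x; apply: negbTE (gi x).
  rewrite -(leq_pmul2l (isT : 0 < 2)) (card_edges gs' gi') mulnDr mulnA.
  have := @free_edge_bound _ T F (ffrel g) s gs' gi' c3 b1 ss hs hk _ nH nF.
  by rewrite card_ord; apply; clear -hn; lia.
have hm1 : ell s - 1 < n by clear -hn; lia.
have hm2 : ell s < n by clear -hn; lia.
(* The extremal graph: the first [ell s - 1] vertices form the small side, and the next two are the
   ends of the possible added edge. *)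
pose S := [set i : 'I_n | i < ell s - 1].
have cS : #|S| = ell s - 1.
  have winj : injective (widen_ord (ltnW hm1)) by move=> a b E; apply: val_inj; case: E.
  rewrite -[RHS]card_ord -[RHS](card_imset _ winj).
  congr #|pred_of_set _|; apply/setP=> i; rewrite inE; apply/idP/imsetP => [il|[j _ ->]].
    by exists (Ordinal il) => //; apply: val_inj.
  exact: (ltn_ord j).
pose o1 : 'I_n := Ordinal hm1; pose o2 : 'I_n := Ordinal hm2.
have o1S : o1 \notin S by rewrite inE ltnn.
have o2S : o2 \notin S by rewrite inE /= -leqNgt leq_subr.
have o12 : o1 != o2 by rewrite -val_eqE /=; clear -ell0; lia.
pose D := ~~ propR F s; pose b := biclique S o1 o2 D.
pose g : {ffun 'I_n * 'I_n -> bool} := [ffun p => b p.1 p.2].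
have gE : ffrel g =2 b by move=> x y; rewrite /ffrel ffunE.
have gs : symmetric (ffrel g) by move=> x y; rewrite !gE; apply: biclique_sym.
have gi : irreflexive (ffrel g) by move=> x; rewrite gE; apply: biclique_irr.
have -> : (ell s - 1) * (n - (ell s - 1)) + D_FH F s = nedges (ffrel g).
  apply/eqP; rewrite -(eqn_pmul2l (isT : 0 < 2)) card_edges //; apply/eqP.
  have -> : e2 (ffrel g) setT setT = e2 b setT setT.
    by apply: eq_bigr => x _; apply: eq_bigr => y _; rewrite gE.
  rewrite biclique_e2 // cS; congr (2 * (_ * _ + _)); last by rewrite /D_FH /D; case: propR.
  by have := cardsC S; rewrite card_ord cS; clear; lia.
apply: (leq_bigmax_cond (F := fun g => nedges (ffrel g))); apply/and3P; split.
- apply/andP; split; first by apply/forallP=> x; rewrite -/(ffrel g x x) gi.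
  by apply/forallP=> x; apply/forallP=> y; rewrite -/(ffrel g x y) gs.
- rewrite (eq_contains _ gE); apply: biclique_linear_free => //.
    by rewrite cS; clear -ell0; lia.
  by rewrite /D /propR negb_or => /andP[+ _]; rewrite -all_predC.
- rewrite (eq_contains _ gE); apply: biclique_book_free => //.
  rewrite /D /propR !negb_or -ltnNge cS => /and3P[_ h1 h2].
  have -> : (ell s - 1).+1 = ell s by clear -ell0; lia.
  by rewrite h1 h2.
Qed.
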